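(* There is a function $f(\Delta,k)\in O\!\left(\Delta k^{8k-7}\log^k(k)\right)$ such that the following holds. Let $G$ be an ordered graph with maximum degree $\Delta$ and let $k$ be the largest integer such that $G$ contains a $k$-thick pattern. Then $k\le\mathrm{mn}(G)\le f(\Delta,k)$.
   Context: An ordered graph is a graph with a total order $\prec$ on its vertices. Two edges $uv$, $xy$ ($u\prec v$, $x\prec y$, four distinct endpoints) cross if $u\prec x\prec v\prec y$ or $x\prec u\prec y\prec v$ and nest if $u\prec x\prec y\prec v$ or $x\prec u\prec v\prec y$. A stack (queue) is an edge set with no two crossing (nesting) edges; $\mathrm{mn}(G)$ is the minimum $s+q$ such that the edges can be partitioned into $s$ stacks and $q$ queues with respect to the given order. A $k$-twist ($k$-rainbow) is a set of $k$ pairwise crossing (nesting) edges. A $t$-thick $k$-twist consists of $k$ pairwise vertex-disjoint $t$-rainbows such that every edge crosses every edge of the other rainbows; a $t$-thick $k$-rainbow consists of $k$ pairwise vertex-disjoint $t$-twists such that every edge nests with every edge of the other twists. A $k$-thick pattern is a $k$-thick $k$-twist or a $k$-thick $k$-rainbow. An ordered graph contains a pattern if it has a subgraph isomorphic to it via an order-preserving isomorphism. *)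

(* Defs.v *)
From mathcomp Require Import all_boot all_order.

Set Implicit Arguments.
Unset Strict Implicit.
Unset Printing Implicit Defensive.

Import Order.TTheory.

Record ordered_graph := OrderedGraph {
  vertex_disp : Order.disp_t;
  vertex :> finOrderType vertex_disp;
  adj : rel vertex;
  adj_sym : symmetric adj;
  adj_irr : irreflexive adj }.

Definition max_degree (G : ordered_graph) : nat :=
  \max_(v : G) #|[set w : G | adj v w]|.

(* An undirected edge is represented once, as the pair of its left and right
   endpoints. *)
Definition edge (G : ordered_graph) :=
  {a : G * G | (a.1 < a.2)%O && adj a.1 a.2}.

Section EdgeSets.
Variable G : ordered_graph.
Implicit Types (a b : edge G) (S : {set edge G}).

Definition lend a : G := (val a).1.
Definition rend a : G := (val a).2.

(* The strict inequalities force the four endpoints to be distinct. *)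
Definition cross a b : bool :=
  [&& lend a < lend b, lend b < rend a & rend a < rend b]%O ||
  [&& lend b < lend a, lend a < rend b & rend b < rend a]%O.

Definition nest a b : bool :=
  [&& lend a < lend b, lend b < rend b & rend b < rend a]%O ||
  [&& lend b < lend a, lend a < rend a & rend a < rend b]%O.

Definition is_stack S : bool := [forall a in S, forall b in S, ~~ cross a b].

Definition is_queue S : bool := [forall a in S, forall b in S, ~~ nest a b].

Definition is_twist (t : nat) S : Prop :=
  #|S| = t /\ {in S &, forall a b, a != b -> cross a b}.

Definition is_rainbow (t : nat) S : Prop :=
  #|S| = t /\ {in S &, forall a b, a != b -> nest a b}.

Definition endpoints S : {set G} := lend @: S :|: rend @: S.

(* The classes of [c] are the (possibly empty) parts of the partition. *)
Definition mixed_layout (s q : nat) : bool :=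
  [exists c : {ffun edge G -> 'I_s + 'I_q},
    [forall i, is_stack [set a | c a == inl i]] &&
    [forall j, is_queue [set a | c a == inr j]]].

Lemma mixed_layout_exists :
  exists m, [exists s : 'I_m.+1, mixed_layout s (m - s)].
Proof.
exists #|{: edge G}|; apply/existsP; exists ord_max => /=.
apply/existsP; exists [ffun a => inl (enum_rank a)].
apply/andP; split; apply/forallP => i; last first.
  by apply/forall_inP => a; rewrite inE ffunE.
apply/forall_inP => a; rewrite inE ffunE => /eqP [ai].
apply/forall_inP => b; rewrite inE ffunE => /eqP [bi].
have -> : b = a by apply: enum_rank_inj; rewrite ai bi.
by rewrite /cross ltxx.
Qed.

Definition mn : nat := ex_minn mixed_layout_exists.

End EdgeSets.

(* [H] itself is the pattern: the rainbows (twists) cover all its edges, and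
   it has no isolated vertices. *)
Definition is_thick_twist (t k : nat) (H : ordered_graph) : Prop :=
  exists R : 'I_k -> {set edge H},
    [/\ forall i, is_rainbow t (R i),
        forall i j, i != j -> [disjoint endpoints (R i) & endpoints (R j)],
        forall i j, i != j -> {in R i & R j, forall a b, cross a b},
        forall a : edge H, exists i, a \in R i
      & forall v : H, exists i, v \in endpoints (R i)].

Definition is_thick_rainbow (t k : nat) (H : ordered_graph) : Prop :=
  exists T : 'I_k -> {set edge H},
    [/\ forall i, is_twist t (T i),
        forall i j, i != j -> [disjoint endpoints (T i) & endpoints (T j)],
        forall i j, i != j -> {in T i & T j, forall a b, nest a b},
        forall a : edge H, exists i, a \in T i
      & forall v : H, exists i, v \in endpoints (T i)].

Definition is_thick_pattern (k : nat) (H : ordered_graph) : Prop :=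
  is_thick_twist k k H \/ is_thick_rainbow k k H.

(* The image of the strictly increasing (hence injective) map [phi], with the
   images of the edges of [H], is the subgraph of [G] isomorphic to [H]. *)
Definition contains (G H : ordered_graph) : Prop :=
  exists phi : H -> G,
    {homo phi : x y / (x < y)%O} /\ {homo phi : x y / adj x y}.

Definition contains_thick_pattern (G : ordered_graph) (k : nat) : Prop :=
  exists H : ordered_graph, is_thick_pattern k H /\ contains G H.

(* Main.v *)
(* Write K = k + 1, so that no K-thick pattern occurs.

   Separated edges (every left endpoint precedes every right endpoint) are points
   in the plane. Call a box bad if it contains a K-twist and a K-rainbow. Among
   K^2 bad boxes with disjoint projections, Erdos-Szekeres finds K that form a
   monotone sequence, hence a K-thick pattern. So greedy cuts yield K^2 vertical
   strips, each split into K^2 cells none of which is bad, and by Mirsky's theorem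
   a cell needs at most K stacks or K queues.

   In general, induct on the largest j such that a K-thick j-rainbow is allowed.
   Cut the vertex line greedily into segments that minimally contain a K-thick
   (j-1)-rainbow. Edges within a segment are handled by induction, edges between
   consecutive segments are separated, and among the remaining edges a 2K-twist
   would contain a K-twist around a whole segment. So these edges form a circle
   graph of bounded clique number.

   Circle graphs are coloured with exponentially many colours by the layering
   argument of Gyarfas: within a breadth-first layer, up to a quadratic number of
   colours, each interval gains one more interval in a clique crossing it from the
   left or from the right. All bounds are exponential in K, far below k^(8k-7). *)

From HB Require Import structures.
Require Import Defs.
From mathcomp Require Import all_boot all_order all_algebra.
From mathcomp Require Import reals exp.
From mathcomp Require Import boolp zify lra.

Set Implicit Arguments.
Unset Strict Implicit.
Unset Printing Implicit Defensive.

Import Order.TTheory GRing.Theory Num.Theory.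

(** * Layouts and Mirsky's theorem *)

Section Layouts.
Variable E : finType.
Implicit Types (S : {set E}) (x y : E) (r cr ne : rel E).

Definition clique r t (A : {set E}) : Prop :=
  #|A| = t /\ {in A &, forall x y, x != y -> r x y}.

(** Pages are plain numbers, tagged [inl] for stacks and [inr] for queues, so that layouts can be
    shifted and merged by arithmetic. *)
Definition page_ok s q (p : nat + nat) : bool :=
  match p with inl i => i < s | inr j => j < q end.

Definition page_rel cr ne (p : nat + nat) : rel E :=
  if p is inl _ then cr else ne.

Definition layout cr ne S s q : Prop :=
  exists h : E -> nat + nat,
    (forall x, x \in S -> page_ok s q (h x)) /\
    {in S &, forall x y, h x = h y -> ~~ page_rel cr ne (h x) x y}.

Definition colorable r S k : Prop :=
  exists h : E -> nat,
    (forall x, x \in S -> h x < k) /\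
    {in S &, forall x y, h x = h y -> ~~ r x y}.

Lemma clique_sub r t k (A : {set E}) :
  clique r t A -> k <= t -> exists2 B : {set E}, B \subset A & clique r k B.
Proof.
move=> [cA rA] kt; have [B /subsetP BA cB] : exists2 B : {set E}, B \subset A & #|B| = k.
  have : k <= #|A| by rewrite cA.
  rewrite cardE => kA; exists [set x in take k (enum A)].
    apply/subsetP=> x; rewrite inE => /mem_take; by rewrite mem_enum.
  rewrite cardsE; have /card_uniqP -> : uniq (take k (enum A)).
    by apply: take_uniq; apply: enum_uniq.
  by rewrite size_takel.
exists B; first by apply/subsetP.
by split=> // x y /BA xA /BA yA; apply: rA.
Qed.

Lemma layout_colorable_stack cr ne S k : colorable cr S k -> layout cr ne S k 0.
Proof. by case=> h [h1 h2]; exists (inl \o h); split=> [x /h1|x y xS yS [/h2]] //=; apply. Qed.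

Lemma layout_colorable_queue cr ne S k : colorable ne S k -> layout cr ne S 0 k.
Proof. by case=> h [h1 h2]; exists (inr \o h); split=> [x /h1|x y xS yS [/h2]] //=; apply. Qed.

Lemma colorable_layout r ne S k : layout r ne S k 0 -> colorable r S k.
Proof.
case=> h [h1 h2]; exists (fun x => if h x is inl i then i else 0); split.
  by move=> x /h1; case: (h x).
move=> x y xS yS; have := h2 x y xS yS; have := h1 x xS; have := h1 y yS.
by case: (h x) => // i; case: (h y) => // j _ _ H ij; apply: H; rewrite ij.
Qed.

Lemma layout_sub cr ne S S' s q s' q' :
  S' \subset S -> s <= s' -> q <= q' -> layout cr ne S s q -> layout cr ne S' s' q'.
Proof.
move=> /subsetP sub ss qq [h [h1 h2]]; exists h; split.
  by move=> x /sub/h1; case: (h x) => i /= hi; apply: leq_trans hi _.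
by move=> x y /sub xS /sub yS; apply: h2.
Qed.

Lemma layoutU cr ne S1 S2 s1 q1 s2 q2 :
  layout cr ne S1 s1 q1 -> layout cr ne S2 s2 q2 ->
  layout cr ne (S1 :|: S2) (s1 + s2) (q1 + q2).
Proof.
move=> [h [h1 h2]] [g [g1 g2]].
pose sh p := match p with inl i => inl (s1 + i) | inr j => inr (q1 + j) end : nat + nat.
exists (fun x => if x \in S1 then h x else sh (g x)); split.
  move=> x; rewrite inE; case: ifP => [/h1 hx _|_ /= /g1].
    by case: (h x) hx => i /=; lia.
  by case: (g x) => i /=; lia.
move=> x y; rewrite !inE; case: ifP => xS; case: ifP => yS /= xS2 yS2.
- exact: h2.
- by have := h1 _ xS; case: (h x) => i /= hi; case: (g y) => j //= [e]; lia.
- by have := h1 _ yS; case: (h y) => i /= hi; case: (g x) => j //= [e]; lia.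
have := g2 x y xS2 yS2.
by case: (g x) => i; case: (g y) => j //= H [e]; apply: H; congr (_ _); lia.
Qed.

Lemma layout0 cr ne s q : layout cr ne set0 s q.
Proof. by exists (fun _ => inl 0); split=> x; rewrite inE. Qed.

(** Each of the [n] fibres of [d] receives fresh pages. *)
Lemma layout_sum cr ne S s q n (d : E -> nat) :
  (forall x, x \in S -> d x < n) ->
  (forall i, i < n -> layout cr ne [set x in S | d x == i] s q) ->
  layout cr ne S (n * s) (n * q).
Proof.
elim: n S => [|n IH] S dn lay.
  apply: layout_sub (layout0 cr ne 0 0) => //.
  by apply/subsetP=> x /dn; rewrite ltn0.
rewrite !mulSn.
apply: (@layout_sub _ _ ([set x in S | d x == n] :|: [set x in S | d x < n])) (leqnn _) (leqnn _) _.
  by apply/subsetP=> x xS; rewrite !inE xS /=; have := dn x xS; lia.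
apply: layoutU; first exact: lay.
apply: IH => [x|i ni]; first by rewrite inE => /andP[].
apply: layout_sub (lay i (ltnW ni)) => //.
by apply/subsetP=> x; rewrite !inE => /andP[/andP[-> _] ->].
Qed.

(** All fibres share the same pages, since edges of different fibres neither cross nor nest. *)
Lemma layout_fiber cr ne S s q (d : E -> nat) :
  {in S &, forall x y, d x != d y -> ~~ cr x y && ~~ ne x y} ->
  (forall i, layout cr ne [set x in S | d x == i] s q) ->
  layout cr ne S s q.
Proof.
move=> sep /choice[h hP].
exists (fun x => h (d x) x); split=> [x xS|x y xS yS].
  by apply: (hP (d x)).1; rewrite inE xS /=.
have [e|ne_d] := eqVneq (d x) (d y).
  by rewrite -e => ee; apply: (hP (d x)).2 => //; rewrite inE ?xS ?yS ?e /=.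
have /andP[] := sep x y xS yS ne_d.
by move=> a b _; case: (h _ x).
Qed.

Lemma colorable_fiber r S k (d : E -> nat) :
  {in S &, forall x y, d x != d y -> ~~ r x y} ->
  (forall i, colorable r [set x in S | d x == i] k) ->
  colorable r S k.
Proof.
move=> sep col; apply: (@colorable_layout r r); apply: (layout_fiber (d := d)).
  by move=> x y xS yS dxy; rewrite sep.
by move=> i; apply: layout_colorable_stack.
Qed.

Lemma colorable_sub r S S' k k' :
  S' \subset S -> k <= k' -> colorable r S k -> colorable r S' k'.
Proof.
move=> sub kk col; apply: (@colorable_layout r r).
by apply: layout_sub sub kk (leqnn _) (layout_colorable_stack _ col).
Qed.

Lemma colorableU r S1 S2 k1 k2 :
  colorable r S1 k1 -> colorable r S2 k2 -> colorable r (S1 :|: S2) (k1 + k2).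
Proof.
move=> c1 c2; apply: (@colorable_layout r r).
exact: (layoutU (layout_colorable_stack r c1) (layout_colorable_stack r c2)).
Qed.

Lemma colorable_sum r S k n (d : E -> nat) :
  (forall x, x \in S -> d x < n) ->
  (forall i, i < n -> colorable r [set x in S | d x == i] k) ->
  colorable r S (n * k).
Proof.
move=> dn col; apply: (@colorable_layout r r).
rewrite -[0](muln0 n); apply: layout_sum dn _ => i ni.
exact: layout_colorable_stack (col i ni).
Qed.

(* Mirsky's theorem: colour by the size of a longest chain below. *)
Lemma mirsky r S k :
  irreflexive r -> {in S & &, transitive r} ->
  (forall C : {set E}, C \subset S ->
     {in C &, forall x y, x != y -> r x y || r y x} -> #|C| <= k) ->
  colorable (fun x y => r x y || r y x) S k.
Proof.
move=> irr tr chk.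
pose below x (C : {set E}) := [&& C \subset S, [forall y in C, r y x] &
  [forall y in C, [forall z in C, (y != z) ==> (r y z || r z y)]]].
pose h x := \max_(C : {set E} | below x C) #|C|.
have belowP x C : below x C -> [/\ C \subset S, {in C, forall y, r y x} &
  {in C &, forall y z, y != z -> r y z || r z y}].
  move=> /and3P[CS /forall_inP Cx /forall_inP CC]; split=> // y z yC zC yz.
  by have /forall_inP/(_ z zC)/implyP/(_ yz) := CC y yC.
have ext x C : x \in S -> below x C ->
  [/\ x |: C \subset S, {in x |: C &, forall y z, y != z -> r y z || r z y}
    & #|x |: C| = #|C|.+1].
  move=> xS /belowP[CS Cx CC]; split.
  - by apply/subsetP=> y; rewrite !inE => /orP[/eqP->//|/(subsetP CS)].
  - move=> y z; rewrite !inE => /orP[/eqP->|yC] /orP[/eqP->|zC] yz.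
    + by rewrite eqxx in yz.
    + by rewrite (Cx z zC) orbT.
    + by rewrite (Cx y yC).
    + exact: CC.
  by rewrite cardsU1; case: (boolP (x \in C)) => // /Cx; rewrite irr.
have hmax x : exists2 C, below x C & h x = #|C|.
  have b0 : below x set0.
    by rewrite /below sub0set /=; apply/andP; split; apply/forall_inP=> y; rewrite inE.
  have [|C bC e] := eq_bigmax_cond (fun C : {set E} => #|C|) (A := below x).
    by apply/card_gt0P; exists set0.
  by exists C.
have hlt : {in S &, forall x y, r x y -> h x < h y}.
  move=> x y xS yS rxy; have [C bC ->] := hmax x.
  have [sub ch card] := ext x C xS bC.
  rewrite -card; apply: (leq_bigmax_cond (P := below y)); apply/and3P; split=> //.
    apply/forall_inP=> z; rewrite !inE => /orP[/eqP->//|zC].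
    have [CS Cx _] := belowP _ _ bC; apply: (tr x z y) => //; last exact: Cx.
    exact: (subsetP CS).
  apply/forall_inP=> u uC; apply/forall_inP=> v vC; apply/implyP; exact: ch.
exists h; split.
  move=> x xS; have [C bC ->] := hmax x.
  by have [sub ch <-] := ext x C xS bC; apply: chk.
move=> x y xS yS e; apply/negP=> /orP[rxy|ryx].
  by have := hlt x y xS yS rxy; rewrite e ltnn.
by have := hlt y x yS xS ryx; rewrite e ltnn.
Qed.

End Layouts.

(** * Colouring circle graphs *)

Section Intervals.
Variables (E : finType) (L R : E -> nat).
Implicit Types (x y z : E) (X : {set E}).

Definition crossl x y := [&& L x < L y, L y < R x & R x < R y].
Definition crossing : rel E := fun x y => crossl x y || crossl y x.
Definition nestl x y := (L x < L y) && (R y < R x).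
Definition nesting : rel E := fun x y => nestl x y || nestl y x.
Definition inside x z := (L z <= L x) && (R x <= R z).

Lemma crossing_sym : symmetric crossing.
Proof. by move=> x y; rewrite /crossing orbC. Qed.

Lemma nesting_sym : symmetric nesting.
Proof. by move=> x y; rewrite /nesting orbC. Qed.

End Intervals.

Section CircleGraph.
Variables (E : finType) (L R : E -> nat).
Hypothesis LR : forall e, L e < R e.
Hypothesis LR_inj : forall x y, L x = L y -> R x = R y -> x = y.
Variable w : nat.
Local Notation xc := (crossing L R).
Local Notation xl := (crossl L R).
Local Notation ins := (inside L R).
Hypothesis clique_le : forall A : {set E},
  {in A &, forall x y, x != y -> xc x y} -> #|A| <= w.
Implicit Types (x y z : E) (X : {set E}).

(** When no interval lies inside another, left and right endpoints come in the same order. If [x]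
    crosses [y] from the left, the members starting between them cross pairwise, so the ranks of [x]
    and [y] are distinct and differ by less than [w]: ranks modulo [w] are a proper colouring. *)
Lemma colorable_antichain (M : {set E}) :
  {in M &, forall x y, ins x y -> x = y} -> colorable xc M w.
Proof.
move=> anti.
pose rk x := #|[set u in M | L u < L x]|.
have mono x y : x \in M -> y \in M -> L x < L y -> R x < R y.
  move=> xM yM lt; rewrite ltnNge; apply/negP=> le.
  have := anti y x yM xM; rewrite /inside (ltnW lt) le => /(_ isT) e.
  by rewrite e ltnn in lt.
have key x y : x \in M -> y \in M -> xl x y -> rk x < rk y /\ rk y < rk x + w.
  move=> xM yM /and3P[l1 l2 l3].
  pose B := [set u in M | (L x <= L u) && (L u <= L y)].
  have Bw : #|B| <= w.
    apply: clique_le => u v; rewrite !inE => /and3P[uM u1 u2] /and3P[vM v1 v2] uv.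
    have [e|ne] := eqVneq (L u) (L v).
      case/eqP: uv; case: (ltngtP (R u) (R v)) => [r|r|]; last exact: LR_inj.
        by apply: anti => //; rewrite /inside e leqnn (ltnW r).
      by apply/esym/anti => //; rewrite /inside e leqnn (ltnW r).
    have hx z : z \in M -> L x <= L z -> R x <= R z.
      move=> zM; rewrite leq_eqVlt => /orP[/eqP e|/(mono _ _ xM zM)/ltnW//].
      have [//|r] := leqP (R x) (R z).
      have zx : z = x by apply: anti => //; rewrite /inside e leqnn (ltnW r).
      by rewrite zx ltnn in r.
    have := hx u uM u1; have := hx v vM v1; have := mono u v uM vM; have := mono v u vM uM.
    by rewrite /crossing /crossl; lia.
  split.
    apply: proper_card; apply/properP; split.
      by apply/subsetP=> u; rewrite !inE => /andP[-> /= /leq_trans]; apply; exact: ltnW.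
    by exists x; rewrite !inE xM /= ?ltnn.
  suff : rk y < rk x + #|B| by move=> /leq_trans; apply; rewrite leq_add2l.
  apply: (@leq_trans #|[set u in M | L u < L x] :|: B|).
    apply: proper_card; apply/properP; split.
      by apply/subsetP=> u; rewrite !inE => /andP[-> /=]; lia.
    by exists y; rewrite !inE yM /= ?ltnn // leqnn (ltnW l1) orbT.
  exact: leq_card_setU.
have w0 x : x \in M -> 0 < w.
  move=> _; rewrite -(cards1 x); apply: clique_le => u v; rewrite !inE => /eqP-> /eqP->.
  by rewrite eqxx.
exists (fun x => rk x %% w); split=> [x xM|x y xM yM e]; first by rewrite ltn_mod (w0 x).
have nomod u v : u \in M -> v \in M -> rk u %% w = rk v %% w -> ~~ xl u v.
  move=> uM vM /eqP uv; apply/negP=> /(key u v uM vM)[k1 k2].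
  have /dvdn_leq : w %| rk v - rk u by rewrite -eqn_mod_dvd 1?eq_sym ?(ltnW k1).
  by rewrite subn_gt0 k1 => /(_ isT); lia.
by rewrite /crossing negb_or !nomod.
Qed.

(** Send each interval to a maximal one [m x] around it. The maximal ones form an antichain and take
    [w] colours. Distinct maximal ones of equal colour do not overlap, and within a fibre of [m] all
    intervals overlap, so [crossl] is transitive there and Mirsky's theorem applies. *)
Lemma colorable_no_disjoint (U : {set E}) :
  (forall x x1 x2, x \in U -> x1 \in U -> x2 \in U ->
     ins x1 x -> ins x2 x -> L x2 < R x1) ->
  colorable xc U (w * w).
Proof.
move=> pw.
have ex x : exists m, x \in U -> [/\ m \in U, ins x m &
    forall u, u \in U -> ins m u -> u = m].
  have [xU|//] := boolP (x \in U); last by exists x.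
  have xx : (x \in U) && ins x x by rewrite xU /inside !leqnn.
  (* A longest member of [U] around [x] is maximal for inclusion. *)
  case: (@arg_maxnP _ x [pred u | (u \in U) && ins x u] (fun u => R u - L u) xx) => m /andP[mU xm] mx.
  exists m => _; split=> // u uU /andP[mu1 mu2].
  have := mx u; rewrite inE /= uU; move: xm => /andP[xm1 xm2].
  have -> : ins x u by apply/andP; lia.
  move=> /(_ isT) le; have := LR u; have := LR m => lm lu.
  by apply: LR_inj; lia.
have /choice[m mP] := ex; clear ex.
have [c [c1 c2]] : colorable xc (m @: U) w.
  apply: colorable_antichain => _ _ /imsetP[x xU ->] /imsetP[y yU ->] xy.
  by have [mU _ mm] := mP x xU; have [yM _ _] := mP y yU; rewrite (mm _ yM xy).
apply: (colorable_sum (d := fun x => c (m x))) => [x xU|i iw].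
  exact/c1/imset_f.
apply: (colorable_fiber (d := fun x => enum_rank (m x))).
  move=> x y; rewrite !inE => /andP[xU /eqP cx] /andP[yU /eqP cy].
  have [-> |mxy _] := eqVneq (m x) (m y); first by rewrite eqxx.
  have cxy : c (m x) = c (m y) by rewrite cx cy.
  have := c2 _ _ (imset_f m xU) (imset_f m yU) cxy; apply: contra => xy.
  have [mxU xmx mx] := mP x xU; have [myU ymy my] := mP y yU.
  have nxy : ~~ ins (m x) (m y) by apply: contraNN mxy => /(mx _ myU)->.
  have nyx : ~~ ins (m y) (m x) by apply: contraNN mxy => /(my _ mxU)->.
  move: nxy nyx xmx ymy xy; rewrite /inside /crossing /crossl; lia.
move=> e; set F := [set x in _ | _].
have FP x y : x \in F -> y \in F -> [/\ x \in U, y \in U, L x < R y & L y < R x].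
  rewrite !inE => /andP[/andP[xU _] /eqP ex] /andP[/andP[yU _] /eqP ey].
  have exy : m x = m y by apply/enum_rank_inj/val_inj; rewrite /= ex ey.
  have [mU xm _] := mP x xU; have [_ ym _] := mP y yU; rewrite -exy in ym.
  by split=> //; [apply: (pw _ _ _ mU yU xU) | apply: (pw _ _ _ mU xU yU)].
apply: mirsky => [x|y x z yF xF zF|C CF CC]; first by rewrite /crossl ltnn.
  by have [_ _] := FP x z xF zF; rewrite /crossl; lia.
exact: clique_le.
Qed.

(** The clique crosses all of [X] around [x], so it also serves every larger interval of [X]. Its
    own members may lie outside [X]. *)
Definition left_clique a X := forall x, x \in X -> exists2 A : {set E},
  clique xc a A & forall y z, y \in A -> z \in X -> ins x z -> xl y z.
Definition right_clique b X := forall x, x \in X -> exists2 A : {set E},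
  clique xc b A & forall y z, y \in A -> z \in X -> ins x z -> xl z y.

Lemma left_clique_sub a X X' : X' \subset X -> left_clique a X -> left_clique a X'.
Proof.
move=> /subsetP sub lX x /sub/lX[A cA Ax]; exists A => // y z yA /sub; exact: Ax.
Qed.

Lemma right_clique_sub a X X' : X' \subset X -> right_clique a X -> right_clique a X'.
Proof.
move=> /subsetP sub lX x /sub/lX[A cA Ax]; exists A => // y z yA /sub; exact: Ax.
Qed.

Lemma cliqueU1 a (A : {set E}) y :
  clique xc a A -> (forall x, x \in A -> xc y x) -> clique xc a.+1 (y |: A).
Proof.
move=> [cA AA] yA; split.
  rewrite cardsU1 cA; case: (boolP (y \in A)) => // /yA.
  by rewrite /crossing /crossl ltnn.
move=> u v; rewrite !inE => /orP[/eqP->|uA] /orP[/eqP->|vA] uv.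
- by rewrite eqxx in uv.
- exact: yA.
- by rewrite crossing_sym yA.
- exact: AA.
Qed.

Lemma left_clique_le a X x : x \in X -> left_clique a X -> a < w.
Proof.
move=> xX /(_ x xX)[A cA Ax].
have [<- h] : clique xc a.+1 (x |: A); last exact: clique_le.
apply: cliqueU1 => // y yA; rewrite crossing_sym /crossing Ax //.
by rewrite /inside !leqnn.
Qed.

Lemma right_clique_le a X x : x \in X -> right_clique a X -> a < w.
Proof.
move=> xX /(_ x xX)[A cA Ax].
have [<- h] : clique xc a.+1 (x |: A); last exact: clique_le.
apply: cliqueU1 => // y yA; rewrite /crossing Ax //.
by rewrite /inside !leqnn.
Qed.

(* The intervals of [X'] containing two disjoint members [x1], [x2] of [X'],
   in this order; an interval of [X] crossing [x2] from outside contains [x1]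
   and is hence crossed by the clique of [x1]. *)
Definition spread X' := [set x in X' | [exists x1 in X', exists x2 in X',
  [&& ins x1 x, ins x2 x & R x1 <= L x2]]].

Lemma spreadP X' x : x \in spread X' -> x \in X' /\ exists x1 x2,
  [/\ x1 \in X', x2 \in X', ins x1 x, ins x2 x & R x1 <= L x2].
Proof.
rewrite inE => /andP[xX /exists_inP[x1 x1X /exists_inP[x2 x2X /and3P[? ? ?]]]].
by split=> //; exists x1, x2.
Qed.

Lemma spread_sub X' : spread X' \subset X'.
Proof. by apply/subsetP=> x /spreadP[]. Qed.

(** Outside [spread X'] any two members inside a common one overlap, so [colorable_no_disjoint]
    handles them. *)
Lemma colorable_spread X' k :
  colorable xc (spread X') k -> colorable xc X' (w * w + k).
Proof.
move=> cS; have cU : colorable xc (X' :\: spread X') (w * w).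
  apply: colorable_no_disjoint => x x1 x2 /setDP[xX xU] /setDP[x1X _] /setDP[x2X _] i1 i2.
  rewrite ltnNge; apply: contra xU => le; rewrite inE xX /=.
  by apply/exists_inP; exists x1 => //; apply/exists_inP; exists x2; rewrite // i1 i2.
apply: colorable_sub (leqnn _) (colorableU cU cS).
by apply/subsetP=> x xX; rewrite in_setU in_setD xX andbT orNb.
Qed.

(** Since [x] contains [x2], the neighbour [y] of [x2] starts left of [x] and reaches past [x1]; it
    joins the clique of [x1]. *)
Lemma left_clique_step a X X' : X' \subset X -> left_clique a X ->
  (forall x, x \in X' -> exists2 y, y \in X &
     forall z, z \in X' -> ins x z -> xl y z) ->
  left_clique a.+1 (spread X').
Proof.
move=> /subsetP sub lX nb x /spreadP[xX [x1 [x2 [x1X x2X i1 i2 d]]]].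
have [A cA Ax1] := lX x1 (sub _ x1X); have [y yX yx2] := nb x2 x2X.
have yx : xl y x by apply: yx2.
have yxx2 : xl y x2 by apply: yx2 => //; rewrite /inside !leqnn.
have x1y : ins x1 y by move: yx yxx2 i1 i2; rewrite /inside /crossl; lia.
exists (y |: A).
  by apply: cliqueU1 => // u uA; rewrite crossing_sym /crossing Ax1.
have tr u v : ins u x -> ins x v -> ins u v by rewrite /inside; lia.
move=> u z; rewrite in_setU1 => /orP[/eqP->|uA] /(subsetP (spread_sub _)) zX xz.
  by apply: yx2 => //; apply: tr xz.
by apply: Ax1 => //; [apply: sub | apply: tr xz].
Qed.

(** Mirror image: the neighbour is taken at [x1] and the clique at [x2]. *)
Lemma right_clique_step a X X' : X' \subset X -> right_clique a X ->
  (forall x, x \in X' -> exists2 y, y \in X &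
     forall z, z \in X' -> ins x z -> xl z y) ->
  right_clique a.+1 (spread X').
Proof.
move=> /subsetP sub lX nb x /spreadP[xX [x1 [x2 [x1X x2X i1 i2 d]]]].
have [A cA Ax2] := lX x2 (sub _ x2X); have [y yX yx1] := nb x1 x1X.
have yx : xl x y by apply: yx1.
have yxx1 : xl x1 y by apply: yx1 => //; rewrite /inside !leqnn.
have x2y : ins x2 y by move: yx yxx1 i1 i2; rewrite /inside /crossl; lia.
exists (y |: A).
  by apply: cliqueU1 => // u uA; rewrite /crossing Ax2.
have tr u v : ins u x -> ins x v -> ins u v by rewrite /inside; lia.
move=> u z; rewrite in_setU1 => /orP[/eqP->|uA] /(subsetP (spread_sub _)) zX xz.
  by apply: yx1 => //; apply: tr xz.
by apply: Ax2 => //; [apply: sub | apply: tr xz].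
Qed.

Lemma exists_outermost X : X != set0 -> exists2 v, v \in X &
  forall z, z \in X -> ins v z -> z = v.
Proof.
move=> /set0Pn[x xX].
case: (@arg_maxnP _ x (mem X) (fun u => R u - L u) xX) => v vX vm.
exists v => // z zX /andP[i1 i2]; have := vm z zX; have := LR z; have := LR v => lv lz le.
by apply: LR_inj; lia.
Qed.

(* Breadth-first search in the crossing graph on [X]. *)
Lemma bfs X v : v \in X -> exists (C : {set E}) (d : E -> nat),
  [/\ v \in C, C \subset X, forall x, x \in C -> d x = 0 -> x = v,
    forall x z, x \in C -> z \in X -> xc x z -> z \in C /\ d z <= (d x).+1
  & forall x n, x \in C -> d x = n.+1 -> exists2 y, y \in C & d y = n /\ xc y x].
Proof.
move=> vX.
(* [B n] is the ball of radius [n] about [v]. The union [C] of all balls is the component of [v],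
   and on [C] the distance [d] is the least radius. *)
pose B n := iter n (fun S => S :|: [set x in X | [exists y in S, xc y x]]) [set v].
have BS n x : x \in B n.+1 -> x \in B n \/ (x \in X /\ exists2 y, y \in B n & xc y x).
  rewrite /B iterS inE => /orP[|]; first by left.
  by rewrite inE => /andP[xX /exists_inP[y yB yx]]; right; split=> //; exists y.
have SB n x y : y \in B n -> x \in X -> xc y x -> x \in B n.+1.
  move=> yB xX yx; rewrite /B iterS !inE xX /=; apply/orP; right.
  by apply/exists_inP; exists y.
have BX n : B n \subset X.
  by elim: n => [|n IH]; apply/subsetP=> x;
    [rewrite inE => /eqP-> | move=> /BS[/(subsetP IH)|[]]].
pose C := [set x | `[<exists n, x \in B n>]].
have ex x : exists n, x \in C -> x \in B n /\ forall m, x \in B m -> n <= m.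
  case: (boolP (x \in C)) => [|_]; last by exists 0.
  rewrite inE => /asboolP ex; case: (ex_minnP ex) => n xn nm.
  by exists n.
have /choice[d dP] := ex; clear ex.
have inC n x : x \in B n -> x \in C by move=> xB; rewrite inE; apply/asboolP; exists n.
have vB : v \in B 0 by rewrite inE.
exists C, d; split.
- exact: inC vB.
- by apply/subsetP=> x; rewrite inE => /asboolP[n /(subsetP (BX n))].
- by move=> x /dP[xB _] d0; move: xB; rewrite d0 inE => /eqP.
- move=> x z /dP[xB _] zX xz; have zB := SB _ _ _ xB zX xz.
  have zC := inC _ _ zB; split=> //; exact: (dP z zC).2.
- move=> x n /dP[xB xm] dx; move: xB; rewrite dx => /BS[/xm|[xX [y yB yx]]].
    by rewrite dx ltnn.
  have yC := inC _ _ yB; exists y => //; split=> //; apply/eqP; rewrite eqn_leq (dP y yC).2 //=.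
  have := xm _ (SB _ _ _ (dP y yC).1 xX yx); by rewrite dx.
Qed.

(** Here [n] is the total size still missing from the two cliques. The factor 4 pays for the parity
    of the layer and the side of the crossing, and [w * w] for [colorable_spread]. *)
Fixpoint circle_bound n := if n is n'.+1 then 4 * (w * w + circle_bound n') else 0.

(* Within a breadth-first layer, a member of the previous layer crossing [x]
   crosses every member of the layer around [x], since otherwise its whole
   path to the outermost root would stay inside that member. *)
Lemma colorable_circle_cliques n a b X : a + b + n = 2 * w ->
  left_clique a X -> right_clique b X -> colorable xc X (circle_bound n).
Proof.
elim: n a b X => [|n IH] a b X abn lX rX.
  have [->|[x xX]] := set_0Vmem X; first exact/(@colorable_layout _ xc xc)/layout0.
  (* A member of [X] forces both [a] and [b] below [w], against [a + b = 2 * w]. *)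
  have := left_clique_le xX lX; have := right_clique_le xX rX; lia.
(* The inner induction on the size of [X] splits off one component of the crossing graph at a
   time. *)
have [m Xm] := ubnP #|X|; elim: m X Xm lX rX => // m IHm X Xm lX rX.
have [->|X0] := eqVneq X set0; first exact/(@colorable_layout _ xc xc)/layout0.
have [v vX vout] := exists_outermost X0.
have [C [d [vC CX d0 dS dP]]] := bfs vX.
have w0 : 0 < w by apply: leq_ltn_trans (left_clique_le vX lX).
(* If [y] of an earlier layer lay inside [z], its predecessor, at least two layers before [z], could
   not cross [z] and would lie inside [z] too. Descending to the root contradicts that [v] is
   outermost. *)
have stay : forall k y z, y \in C -> z \in C -> d y = k -> k < d z -> ins y z -> False.
  elim=> [|k IHk] y z yC zC dy dz yz.
    have yv := d0 y yC dy; rewrite yv in yz.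
    have zv := vout z (subsetP CX z zC) yz.
    by rewrite zv -yv dy in dz.
  have [u uC [du uy]] := dP y k yC dy.
  have nuz : ~~ xc u z.
    apply/negP=> uz; have [_] := dS u z uC (subsetP CX z zC) uz; rewrite du; lia.
  apply: (IHk u z) => //; first lia.
  by move: uy nuz yz; rewrite /crossing /crossl /inside; have := LR u; lia.
have cross_layer x y z : x \in C -> y \in C -> z \in C ->
    d y < d z -> ins x z -> xc y x -> xl y x = xl y z /\ xl x y = xl z y.
  move=> xC yC zC dyz xz yx; have := stay _ _ _ yC zC erefl dyz.
  move: yx xz; rewrite /crossing /crossl /inside; have := LR x; have := LR y; have := LR z.
  case: (boolP ((L z <= L y) && (R y <= R z))) => [_ _ _ _ _ _ /(_ isT)//|]; lia.
have colX : colorable xc (X :\: C) (circle_bound n.+1).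
  apply: IHm; last 2 first.
  - by apply: left_clique_sub lX; apply: subsetDl.
  - by apply: right_clique_sub rX; apply: subsetDl.
  apply: leq_trans (proper_card _) (ltnSE Xm); apply/properP; split; first exact: subsetDl.
  by exists v; rewrite // inE vC.
have colLayer i : colorable xc [set x in C | d x == i] (2 * (w * w + circle_bound n)).
  case: i => [|i].
    exists (fun _ => 0); split=> [x _|x y]; first by rewrite muln_gt0 addn_gt0 muln_gt0 w0.
    rewrite !inE => /andP[xC /eqP/(d0 x xC)->] /andP[yC /eqP/(d0 y yC)->] _.
    by rewrite /crossing /crossl ltnn.
  set N := [set x in C | _].
  have NP x : x \in N -> x \in C /\ d x = i.+1 by rewrite inE => /andP[? /eqP].
  (* Members of the layer outside [NL] are crossed from the right by the previous layer. *)
  pose NL := [set x in N | [exists y in C, (d y == i) && xl y x]].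
  have NX : N \subset X by apply/subsetP=> x /NP[/(subsetP CX)].
  have NLN : NL \subset N by apply/subsetP=> x; rewrite inE => /andP[].
  have NRN : N :\: NL \subset N by exact: subsetDl.
  have NLP x : x \in NL -> exists y, [/\ y \in C, d y = i & xl y x].
    by rewrite inE => /andP[_ /exists_inP[y yC /andP[/eqP dy yx]]]; exists y.
  have cL : colorable xc NL (w * w + circle_bound n).
    apply/colorable_spread/(IH a.+1 b); first by lia.
      apply: left_clique_step lX _; first exact: subset_trans NLN NX.
      move=> x xNL; have [y [yC dy yx]] := NLP x xNL; have [xC dx] := NP x (subsetP NLN x xNL).
      exists y => [|z /(subsetP NLN)/NP[zC dz] xz]; first exact: (subsetP CX).
      have dyz : d y < d z by rewrite dy dz.
      have xcyx : xc y x by rewrite /crossing yx.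
      by have [<-] := cross_layer x y z xC yC zC dyz xz xcyx.
    apply: right_clique_sub rX; apply: subset_trans (spread_sub _) _; exact: subset_trans NLN NX.
  have cR : colorable xc (N :\: NL) (w * w + circle_bound n).
    apply/colorable_spread/(IH a b.+1); first by lia.
      apply: left_clique_sub lX; apply: subset_trans (spread_sub _) _; exact: subset_trans NRN NX.
    apply: right_clique_step rX _; first exact: subset_trans NRN NX.
    move=> x /setDP[xN xNL]; have [xC dx] := NP x xN; have [y yC [dy yx]] := dP x i xC dx.
    have xy : xl x y.
      move: yx; rewrite /crossing; case: (boolP (xl y x)) => //= yx; case/negP: xNL.
      by rewrite inE xN; apply/exists_inP; exists y; rewrite // dy eqxx yx.
    exists y => [|z /(subsetP NRN)/NP[zC dz] xz]; first exact: (subsetP CX).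
    have dyz : d y < d z by rewrite dy dz.
    by have [_ <-] := cross_layer x y z xC yC zC dyz xz yx.
  apply: colorable_sub (colorableU cL cR); last by lia.
  by apply/subsetP=> x xN; rewrite in_setU in_setD xN andbT orbN.
have colC : colorable xc C (circle_bound n.+1).
  have -> : circle_bound n.+1 = 2 * (2 * (w * w + circle_bound n)).
    by rewrite mulnA.
  (* Crossing intervals lie in equal or consecutive layers, so layers of the same parity share
     colours. *)
  apply: (colorable_sum (d := fun x => d x %% 2)) => [x _|p _]; first by rewrite ltn_mod.
  apply: (colorable_fiber (d := d)) => [x y|i].
    rewrite !inE => /andP[xC xp] /andP[yC yp] dxy; apply/negP=> xy.
    have [_ le1] := dS x y xC (subsetP CX y yC) xy; rewrite crossing_sym in xy.
    have [_ le2] := dS y x yC (subsetP CX x xC) xy.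
    by move: xp yp dxy le1 le2; lia.
  apply: colorable_sub (leqnn _) (colLayer i).
  by apply/subsetP=> x; rewrite !inE => /andP[/andP[-> _] ->].
apply: (colorable_fiber (d := fun x => x \in C : nat)).
  move=> x y xX yX; case: (boolP (x \in C)) => xC; case: (boolP (y \in C)) => yC //= _; apply/negP.
    by move=> /(dS x y xC yX)[]; rewrite (negbTE yC).
  by rewrite crossing_sym => /(dS y x yC xX)[]; rewrite (negbTE xC).
case=> [|i]; [apply: colorable_sub (leqnn _) colX | apply: colorable_sub (leqnn _) colC];
  apply/subsetP=> x; rewrite !inE; case: (x \in C); rewrite ?andbF //=.
by case/andP.
Qed.

Theorem colorable_circle X : colorable xc X (circle_bound (2 * w)).
Proof.
(* Both cliques start empty, so the full [2 * w] is missing. *)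
have e0 : clique xc 0 set0 by split=> [|x y]; rewrite ?cards0 ?inE.
apply: (@colorable_circle_cliques _ 0 0) => // x _; exists set0 => // y z; by rewrite inE.
Qed.

Lemma circle_bound_le n : circle_bound n <= 4 ^ n * (2 * (w * w)).
Proof.
(* The extra [2 * (w * w)] absorbs the additive term of the recurrence. *)
suff : circle_bound n + 2 * (w * w) <= 4 ^ n * (2 * (w * w)) by lia.
elim: n => [|n IH] /=; first by lia.
rewrite expnS -mulnA; lia.
Qed.

End CircleGraph.

(** * Separated edges *)

Section Segments.
Variable Bad : nat -> nat -> Prop.

Fixpoint chain n v : Prop :=
  if n is n'.+1 then exists a b, [/\ a <= b, b < v, Bad a b & chain n' a] else True.

Lemma chain_le n v : chain n v -> n <= v.
Proof.
elim: n v => // n IH v [a [b [ab bv _ /IH na]]].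
exact: leq_ltn_trans (leq_trans na ab) bv.
Qed.

Lemma chain_mono n u v : u <= v -> chain n u -> chain n v.
Proof.
by case: n => // n uv [a [b [ab bu B ch]]]; exists a, b; split=> //; apply: leq_trans uv.
Qed.

Lemma chain_pred n v : chain n.+1 v -> chain n v.
Proof. by move=> [a [b [ab bv _ ch]]]; apply: chain_mono ch; lia. Qed.

Lemma chain_leq m n v : m <= n -> chain n v -> chain m v.
Proof.
by elim: n => [|n IH]; [case: m|rewrite leq_eqVlt => /orP[/eqP->//|/IH H /chain_pred/H]].
Qed.

Lemma chain_fun n v : chain n v -> exists a b : nat -> nat,
  (forall i, i < n -> [/\ a i <= b i, b i < v & Bad (a i) (b i)]) /\
  (forall i j, i < j < n -> b i < a j).
Proof.
elim: n v => [|n IH] v; first by exists id, id; split=> // i j; rewrite ltn0 andbF.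
move=> [a0 [b0 [ab bv B /IH[a [b [H1 H2]]]]]].
exists (fun i => if i == n then a0 else a i), (fun i => if i == n then b0 else b i); split.
  move=> i; rewrite ltnS leq_eqVlt; case: eqP => [->|_] //= /H1[? ? ?]; split=> //; lia.
move=> i j /andP[ij jn]; have -> : (i == n) = false by lia.
case: eqP => [e|jn0]; last by apply: H2; lia.
by have [] : [/\ a i <= b i, b i < a0 & Bad (a i) (b i)] by apply: H1; lia.
Qed.

(* [chain n v]: there are [n] disjoint bad intervals before [v]. The values of
   [seg] cut the line into classes: only the last point of a class can end a bad
   interval inside that class, and points whose values differ by at least 2
   enclose a bad interval. *)
Definition seg v := \max_(n < v.+1 | `[<chain n v>]) n.

(** A chain before [v] has at most [v] intervals, so the bounded maximum sees all of them;
    conversely, chains can be shortened. *)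
Lemma segP n v : n <= seg v <-> chain n v.
Proof.
split=> [|ch]; last first.
  have nv : n < v.+1 by rewrite ltnS chain_le.
  by apply: (@leq_bigmax_cond _ _ _ (Ordinal nv)); apply/asboolP.
have [|i /asboolP ci e] :=
    @eq_bigmax_cond _ [pred n : 'I_v.+1 | `[<chain n v>]] (fun n : 'I_v.+1 => n : nat).
  by apply/card_gt0P; exists ord0; rewrite inE; apply/asboolP.
by rewrite /seg e => /chain_leq; apply.
Qed.

Lemma seg_mono u v : u <= v -> seg u <= seg v.
Proof. by move=> uv; apply/segP/(chain_mono uv)/segP. Qed.

Lemma seg_bad a b v : a <= b -> b < v -> Bad a b -> seg a < seg v.
Proof. by move=> ab bv B; apply/segP; exists a, b; split=> //; apply/segP. Qed.

(** The last interval of a chain of length [seg u + 1] may start at or before [u]. With one more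
    interval, the last one has [seg u + 1] predecessors before [a], which excludes [a <= u]. *)
Lemma seg_gap u v : seg u + 2 <= seg v -> exists a b, [/\ u < a, a <= b, b < v & Bad a b].
Proof.
rewrite addn2 => /segP[a [b [ab bv B ch]]]; exists a, b; split=> //.
rewrite ltnNge; apply/negP=> /seg_mono; have := (segP (seg u).+1 a).2 ch; lia.
Qed.

Lemma seg_lt m v : (forall v, ~ chain m v) -> seg v < m.
Proof. by move=> nch; rewrite ltnNge; apply/negP=> /segP; apply: nch. Qed.

End Segments.

(** * Disjoint representatives and monotone subsequences *)

Lemma exists_min (E : finType) (X : {set E}) (f : E -> nat) x : x \in X ->
  exists2 m, m \in X & forall y, y \in X -> f m <= f y.
Proof. by move=> xX; case: (@arg_minnP _ x (mem X) f xX) => m mX H; exists m. Qed.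

Lemma exists_max (E : finType) (X : {set E}) (f : E -> nat) x : x \in X ->
  exists2 m, m \in X & forall y, y \in X -> f y <= f m.
Proof. by move=> xX; case: (@arg_maxnP _ x (mem X) f xX) => m mX H; exists m. Qed.

(** Greedy choice: take the family whose interval number [t0] ends first. In every other family, all
    intervals of larger number start after that end. *)
Lemma disjoint_representatives n (J : finType) (I : {set J}) t0 (c d : J -> nat -> nat) (x0 : J) :
  #|I| = n ->
  (forall i t u, i \in I -> t0 <= t -> t < u -> u < t0 + n -> d i t < c i u) ->
  exists s : nat -> J, [/\ forall p, p < n -> s p \in I,
    forall p q, p < q < n -> s p != s q &
    forall p q, p < q < n -> d (s p) (t0 + p) < c (s q) (t0 + q)].
Proof.
elim: n I t0 => [|n IH] I t0 cI sep.
  by exists (fun _ => x0); split=> // p q; rewrite ltn0 andbF.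
have [x xI] : exists x, x \in I by apply/set0Pn; rewrite -card_gt0 cI.
have [m mI mm] := exists_min (fun i => d i t0) xI.
have cI' : #|I :\ m| = n by rewrite (cardsD1 m) mI in cI; case: cI.
have [|s [s1 s2 s3]] := IH (I :\ m) t0.+1 cI'.
  by move=> i t u /setD1P[_ iI] h1 h2 h3; apply: sep => //; lia.
exists (fun p => if p is p'.+1 then s p' else m); split.
- by case=> [//|p] /s1; case/setD1P.
- case=> [|p] [|q] //=; last exact: s2.
  by move=> /s1; case/setD1P; rewrite eq_sym.
case=> [|p] [|q] //=; last by rewrite !addnS -!addSn; apply: s3.
rewrite ltnS addn0 => qn; have /setD1P[_ sI] := s1 q qn.
by apply: leq_ltn_trans (mm _ sI) (sep _ _ _ sI _ _ _); lia.
Qed.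

(** Apply Mirsky's theorem to [r]: either there is an increasing set of size [k], or [k.-1] colours
    suffice, and by pigeonhole some colour class has [k] members, no two of them increasing. *)
Lemma erdos_szekeres k n (f : 'I_n -> nat) : 0 < k -> n = k * k -> injective f ->
  exists P : {set 'I_n}, #|P| = k /\
   ((forall p q, p \in P -> q \in P -> p < q -> f p < f q) \/
    (forall p q, p \in P -> q \in P -> p < q -> f q < f p)).
Proof.
move=> k0 nk finj.
pose r : rel 'I_n := fun p q => (p < q) && (f p < f q).
pose rs : rel 'I_n := fun p q => r p q || r q p.
have [[A cA]|noA] := pselect (exists A, clique rs k A).
  exists A; split; first exact: cA.1; left=> p q pA qA pq.
  have := cA.2 p q pA qA; rewrite /rs /r; move: pq; rewrite -val_eqE /=; lia.
have [h [h1 h2]] : colorable rs [set: 'I_n] k.-1.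
  apply: mirsky => [p|q p u _ _ _|C _ CC]; first by rewrite /r ltnn.
    by rewrite /r; lia.
  have [//|lt] := leqP #|C| k.-1; case: noA.
  have [|B _ cB] := @clique_sub _ rs _ k C (conj erefl CC); first by lia.
  by exists B.
(* The domain is nonempty, so the colouring uses a colour; hence [k] is at least 2. *)
have k1 : 0 < k.-1 by apply: leq_ltn_trans (h1 (Ordinal (_ : 0 < n)) _) => //;
  rewrite nk muln_gt0 k0.
have [k' ek] : exists k', k = k'.+2 by exists k.-2; lia.
subst k; rewrite /= in h1 k1.
have [i hi] : exists i, k'.+2 <= #|[set p | h p == i]|.
  apply: contrapT => /forallNP nex.
  have : #|'I_n| <= \sum_(i < k'.+1) k'.+1.
    rewrite -sum1_card (partition_big (fun p => inord (h p) : 'I_k'.+1) predT) //=.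
    apply: leq_sum => i _; rewrite sum1_card.
    have /negP := nex i; rewrite -ltnNge => lt.
    apply: leq_trans (_ : #|[set p | h p == i]| <= _); last by lia.
    apply: subset_leq_card; apply/subsetP=> p hp; rewrite inE.
    have /eqP <- : inord (h p) == i by exact: hp.
    by rewrite inordK // h1 ?inE.
  by rewrite sum_nat_const !card_ord nk; nia.
have [B /subsetP BF [cB _]] := @clique_sub _ (fun _ _ => true) _ k'.+2 _ (conj erefl (fun _ _ _ _ _ => isT)) hi.
exists B; split=> //; right=> p q /BF; rewrite inE => /eqP hp /BF; rewrite inE => /eqP hq pq.
have := h2 p q; rewrite !inE hp hq => /(_ isT isT erefl).
rewrite /rs /r; have : f p <> f q by move/finj=> e; rewrite e ltnn in pq.
lia.
Qed.

Section Thick.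
Variable E : finType.
Implicit Types (S : {set E}) (r : rel E).

(* Thick twists for [r] nesting and [r'] crossing, thick rainbows for the converse. *)
Definition thick r r' t k S : Prop := exists T : nat -> {set E},
  (forall i, i < k -> T i \subset S /\ clique r t (T i)) /\
  (forall i j, i < k -> j < k -> i != j ->
     forall x y, x \in T i -> y \in T j -> r' x y).

Lemma thick_sub r r' t k S S' : S \subset S' -> thick r r' t k S -> thick r r' t k S'.
Proof.
move=> sub [T [T1 T2]]; exists T; split=> // i /T1[TS cT]; split=> //.
exact: subset_trans sub.
Qed.

Lemma thick_leq r r' t k k' S : k <= k' -> thick r r' t k' S -> thick r r' t k S.
Proof.
move=> kk [T [T1 T2]]; exists T; split=> [i ik|i j ik jk]; first exact/T1/(leq_trans ik).
by apply: T2; apply: leq_trans kk.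
Qed.

Lemma thick_index (J : finType) (P : {set J}) (G : J -> {set E}) r r' t S :
  (forall p, p \in P -> G p \subset S /\ clique r t (G p)) ->
  (forall p q, p \in P -> q \in P -> p != q ->
     forall x y, x \in G p -> y \in G q -> r' x y) ->
  thick r r' t #|P| S.
Proof.
move=> G1 G2; exists (nth set0 [seq G p | p <- enum P]); rewrite cardE.
case: (set_0Vmem P) => [->|[p0 _]]; first by rewrite enum_set0.
split=> [i iP|i j iP jP ij x y].
  by rewrite (nth_map p0) //; apply: G1; rewrite -mem_enum mem_nth.
have inP u : u < size (enum P) -> nth p0 (enum P) u \in P.
  by move=> uP; rewrite -mem_enum mem_nth.
rewrite (nth_map p0) // (nth_map p0) //; apply: G2; [exact: inP | exact: inP |].
by rewrite nth_uniq // enum_uniq.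
Qed.

End Thick.

(** * Separated edges as points in the plane *)

Section Separated.
Variables (E : finType) (L R : E -> nat).
Hypothesis LR : forall e, L e < R e.
Hypothesis LR_inj : forall x y, L x = L y -> R x = R y -> x = y.
Variable K : nat.
Hypothesis K0 : 0 < K.
Local Notation xc := (crossing L R).
Local Notation xn := (nesting L R).
Implicit Types (x y z : E) (S X W : {set E}).

(** One greedy cut along the coordinate [f], used for [L] and for [R]. There are at most [m]
    classes, and each pays one stack for its last coordinate. *)
Lemma layout_classes S (f : E -> nat) (Bad : nat -> nat -> Prop) m s q :
  (forall x y, f x = f y -> ~~ xc x y) ->
  (forall v, ~ chain Bad m v) ->
  (forall W a b, W \subset S -> (forall x, x \in W -> a <= f x <= b) ->
     ~ Bad a b -> layout xc xn W s q) ->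
  layout xc xn S (m * (1 + s)) (m * q).
Proof.
move=> fc nch lay; pose g := seg Bad.
apply: (layout_sum (d := fun x => g (f x))) => [x _|i im]; first exact: seg_lt.
set X := [set x in S | _].
have XS : X \subset S by apply/subsetP=> x; rewrite inE => /andP[].
have XP x : x \in X -> g (f x) = i by rewrite inE => /andP[_ /eqP].
(* The members of [X] outside [Y] all have the last value of [f] in the class, so they form one
   stack. *)
pose Y := [set x in X | g (f x).+1 == i].
have YX : Y \subset X by apply/subsetP=> x; rewrite inE => /andP[].
have layL : layout xc xn (X :\: Y) 1 0.
  apply: layout_colorable_stack; exists (fun=> 0); split=> // x y.
  have lt u v : u \in X :\: Y -> v \in X :\: Y -> f v <= f u.
    move=> /setDP[uX uY] /setDP[vX _]; rewrite leqNgt; apply: contra uY => fuv.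
    rewrite inE uX /= eqn_leq -{1}(XP v vX) seg_mono //= -(XP u uX) seg_mono //.
  move=> xX yX _; apply: fc; apply/eqP; rewrite eqn_leq; by rewrite !lt.
have layY : layout xc xn Y s q.
  have [->|[y0 y0Y]] := set_0Vmem Y; first exact: layout0.
  have [y yY ym] := exists_min f y0Y; have [z zY zm] := exists_max f y0Y.
  apply: (lay _ (f y) (f z)); first exact: subset_trans YX XS.
    by move=> x xY; rewrite ym ?zm.
  (* If the span of [Y] were bad, [seg] would increase by [(f z).+1], which still belongs to the
     class. *)
  move=> B; have := seg_bad (ym z zY) (ltnSn _) B.
  rewrite -/g (XP y (subsetP YX y yY)); move: zY; rewrite inE => /andP[_ /eqP->].
  by rewrite ltnn.
rewrite -[q]add0n; apply: layout_sub (layoutU layL layY) => //.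
by apply/subsetP=> x xX; rewrite in_setU in_setD xX andbT orNb.
Qed.

(** There are [K * K] strips of [K * K] cells, and each cell takes [K] stacks or [K] queues. Each
    summand 1 is the stack at the last coordinate of a strip or cell. *)
Definition sep_stacks := K * K * (1 + K * K * (1 + K)).
Definition sep_queues := K * K * (K * K * K).

(** For separated edges, crossing means that both coordinates are ordered alike, and nesting that
    they are ordered oppositely. *)
Lemma layout_separated S :
  {in S &, forall x y, L x < R y} ->
  ~ thick xn xc K K S -> ~ thick xc xn K K S ->
  layout xc xn S sep_stacks sep_queues.
Proof.
move=> sepS nT nR; pose m := K * K.
pose box a b c d := [set x in S | (a <= L x <= b) && (c <= R x <= d)].
pose Bad2 a b c d := (exists2 A : {set E}, A \subset box a b c d & clique xc K A) /\
  (exists2 A : {set E}, A \subset box a b c d & clique xn K A).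
pose Bad1 a b := exists v, chain (Bad2 a b) m v.
have boxS a b c d : box a b c d \subset S.
  by apply/subsetP=> x; rewrite inE => /andP[].
have nBad1 v : ~ chain Bad1 m v.
  move=> /chain_fun[a [b [H1 H2]]].
  have m0 : 0 < m by rewrite muln_gt0 K0.
  have /choice[cd cdP] : forall i : 'I_m, exists cd : (nat -> nat) * (nat -> nat),
      (forall t, t < m -> cd.1 t <= cd.2 t /\ Bad2 (a i) (b i) (cd.1 t) (cd.2 t)) /\
      (forall t u, t < u < m -> cd.2 t < cd.1 u).
    move=> i; have [_ _ [u /chain_fun[c [d [c1 c2]]]]] := H1 i (ltn_ord i).
    by exists (c, d); split=> // t /c1[].
  (* Strip [s p] contributes its [p]-th bad cell, so that the chosen cells have disjoint projections
     in both directions. *)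
  have [||s [s1 s2 s3]] := @disjoint_representatives m _ [set: 'I_m] 0
      (fun i => (cd i).1) (fun i => (cd i).2) (Ordinal m0).
    by rewrite cardsT card_ord.
    by move=> i t u _ _ tu um; apply: (cdP i).2; rewrite tu.
  have sinj : injective (fun p : 'I_m => s p : nat).
    move=> p q /val_inj e; apply/val_inj; case: (ltngtP p q) => // pq.
      by have := s2 p q; rewrite pq ltn_ord e eqxx => /(_ isT).
    by have := s2 q p; rewrite pq ltn_ord e eqxx => /(_ isT).
  have bx p x : p < m -> x \in box (a (s p)) (b (s p)) ((cd (s p)).1 p) ((cd (s p)).2 p) ->
      [/\ x \in S, a (s p) <= L x, L x <= b (s p), (cd (s p)).1 p <= R x & R x <= (cd (s p)).2 p].
    by move=> _; rewrite inE => /and3P[? /andP[? ?] /andP[? ?]].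
  have bad (p : 'I_m) : Bad2 (a (s p)) (b (s p)) ((cd (s p)).1 p) ((cd (s p)).2 p).
    exact: ((cdP (s p)).1 p (ltn_ord p)).2.
  have yord p q x y : p < q < m -> x \in box (a (s p)) (b (s p)) ((cd (s p)).1 p) ((cd (s p)).2 p) ->
      y \in box (a (s q)) (b (s q)) ((cd (s q)).1 q) ((cd (s q)).2 q) -> R x < R y.
    move=> pqm xp yq; have := s3 p q pqm; rewrite !add0n.
    have [] := bx p x _ xp; first by lia. have [] := bx q y _ yq; first by lia. lia.
  have xord p q x y : p < m -> q < m -> s p < s q ->
      x \in box (a (s p)) (b (s p)) ((cd (s p)).1 p) ((cd (s p)).2 p) ->
      y \in box (a (s q)) (b (s q)) ((cd (s q)).1 q) ((cd (s q)).2 q) -> L x < L y.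
    move=> pm qm pq xp yq; have := H2 (s p) (s q); rewrite pq ltn_ord => /(_ isT).
    have [] := bx p x pm xp; have [] := bx q y qm yq; lia.
  (* Increasing cells combine their rainbows into a thick twist, decreasing cells their twists into
     a thick rainbow. *)
  have [P [cP [inc|dec]]] := erdos_szekeres K0 (erefl m) sinj.
    have /choice[G GP] : forall p : 'I_m, exists A : {set E},
       A \subset box (a (s p)) (b (s p)) ((cd (s p)).1 p) ((cd (s p)).2 p) /\ clique xn K A.
      by move=> p; have [_ [A]] := bad p; exists A.
    apply: nT; rewrite -{2}cP; apply: (thick_index (G := G)).
      by move=> p _; have [Gb cG] := GP p; split=> //; exact: subset_trans Gb (boxS _ _ _ _).
    have main p q x y : p \in P -> q \in P -> p < q -> x \in G p -> y \in G q -> xc x y.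
      move=> pP qP pq /(subsetP (GP p).1) xp /(subsetP (GP q).1) yq.
      have lR : R x < R y by apply: yord xp yq; rewrite pq /=.
      have lL : L x < L y by apply: xord xp yq => //; apply: inc.
      have [xS _ _ _ _] := bx p x (ltn_ord p) xp; have [yS _ _ _ _] := bx q y (ltn_ord q) yq.
      by rewrite /crossing /crossl lL lR sepS.
    move=> p q pP qP; rewrite -val_eqE neq_ltn => /orP[] pq x y xG yG; first exact: main pq xG yG.
    by rewrite crossing_sym; apply: main pq yG xG.
  have /choice[G GP] : forall p : 'I_m, exists A : {set E},
     A \subset box (a (s p)) (b (s p)) ((cd (s p)).1 p) ((cd (s p)).2 p) /\ clique xc K A.
    by move=> p; have [[A] ] := bad p; exists A.
  apply: nR; rewrite -{2}cP; apply: (thick_index (G := G)).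
    by move=> p _; have [Gb cG] := GP p; split=> //; exact: subset_trans Gb (boxS _ _ _ _).
  have main p q x y : p \in P -> q \in P -> p < q -> x \in G p -> y \in G q -> xn x y.
    move=> pP qP pq /(subsetP (GP p).1) xp /(subsetP (GP q).1) yq.
    have lR : R x < R y by apply: yord xp yq; rewrite pq /=.
    have lL : L y < L x by apply: xord yq xp => //; apply: dec.
    by rewrite /nesting /nestl lL lR orbT.
  move=> p q pP qP; rewrite -val_eqE neq_ltn => /orP[] pq x y xG yG; first exact: main pq xG yG.
  by rewrite nesting_sym; apply: main pq yG xG.
apply: (layout_classes (f := L) (Bad := Bad1)) => //.
  by move=> x y e; rewrite /crossing /crossl e ltnn.
move=> W a b WS Wab nB; apply: (layout_classes (f := R) (Bad := Bad2 a b)).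
- by move=> x y e; rewrite /crossing /crossl e ltnn !andbF.
- by move=> v ch; apply: nB; exists v.
move=> Z c d ZW Zcd nB2.
have Zbox : Z \subset box a b c d.
  apply/subsetP=> x xZ; have xW := subsetP ZW x xZ.
  by rewrite inE (subsetP WS x xW) Wab ?Zcd.
have ZS : {in Z &, forall x y, L x < R y}.
  by move=> x y /(subsetP ZW)/(subsetP WS) ? /(subsetP ZW)/(subsetP WS) ?; apply: sepS.
(* A cell with a [K]-twist has no [K]-rainbow and takes queues; any other cell takes stacks, as
   separation makes [crossl] transitive. *)
have [[A AZ cA]|noA] := pselect (exists2 A : {set E}, A \subset Z & clique xc K A).
  apply: (@layout_sub _ _ _ Z Z 0 K) => //; apply: layout_colorable_queue.
  apply: mirsky => [x|y x z _ _ _|C CZ CC]; first by rewrite /nestl ltnn.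
    by rewrite /nestl; lia.
  have [//|lt] := leqP #|C| K.
  have [B BC cB] := clique_sub (conj erefl CC : clique xn _ C) (ltnW lt).
  case: nB2; split; [exists A|exists B] => //; first exact: subset_trans Zbox.
  exact: subset_trans (subset_trans BC CZ) Zbox.
apply: (@layout_sub _ _ _ Z Z K 0) => //; apply: layout_colorable_stack.
apply: mirsky => [x|y x z yZ xZ zZ|C CZ CC]; first by rewrite /crossl ltnn.
  by have := ZS z x zZ xZ; have := ZS x z xZ zZ; have := ZS z y; rewrite /crossl; lia.
have [//|lt] := leqP #|C| K.
have [B BC cB] := clique_sub (conj erefl CC : clique xc _ C) (ltnW lt).
by case: noA; exists B => //; apply: subset_trans CZ.
Qed.

End Separated.

(** * The upper bound for interval systems *)

Section Induction.
Variables (E : finType) (L R : E -> nat).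
Hypothesis LR : forall e, L e < R e.
Hypothesis LR_inj : forall x y, L x = L y -> R x = R y -> x = y.
Variable K : nat.
Hypothesis K0 : 0 < K.
Local Notation xc := (crossing L R).
Local Notation xn := (nesting L R).
Implicit Types (x y z : E) (S X W : {set E}).

Lemma crossing_meet x y : xc x y -> L x < R y.
Proof. by rewrite /crossing /crossl; have := LR x; have := LR y; lia. Qed.

Definition circle_stacks := circle_bound (2 * K) (2 * (2 * K)).

(** The clique bound in [colorable_circle] concerns a whole type, so [X] is turned into a
    subtype. *)
Lemma colorable_no_twist X :
  (forall A : {set E}, A \subset X -> ~ clique xc (2 * K) A) -> colorable xc X circle_stacks.
Proof.
move=> nA; pose U := {x | x \in X}; pose L' (u : U) := L (val u); pose R' (u : U) := R (val u).
have [||A AA|h [h1 h2]] := @colorable_circle U L' R' _ _ (2 * K) _ [set: U].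
- by move=> e; apply: LR.
- by move=> x y e1 e2; apply/val_inj/LR_inj.
- have [//|/ltnW lt] := leqP #|A| (2 * K).
  have [] := @clique_sub _ xc #|A| (2 * K) (val @: A) _ lt.
    split; first exact/card_imset/val_inj.
    move=> _ _ /imsetP[x xA ->] /imsetP[y yA ->]; rewrite (inj_eq val_inj) => xy.
    exact: AA.
  move=> B BA cB; case: (nA B) => //; apply/subsetP=> x /(subsetP BA)/imsetP[u _ ->].
  exact: valP.
exists (fun x => if insub x is Some u then h u else 0); split.
  by move=> x xX; rewrite insubT; apply: h1; rewrite inE.
move=> x y xX yX; rewrite !insubT => e; apply: (h2 (Sub x xX) (Sub y yX)) => //; by rewrite inE.
Qed.

(** Let [r] end first. Either [K] members start two segments before [R r], or [K] members start in
    its segment or the preceding one. In the second case, equal parity puts all these starts into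
    one segment, and each member ends two segments later. *)
Lemma clique_window (g : nat -> nat) X :
  {homo g : u v / u <= v} ->
  (forall x, x \in X -> g (L x) + 2 <= g (R x)) ->
  {in X &, forall x y, g (L x) = g (L y) %[mod 2]} ->
  clique xc (2 * K) X ->
  exists A : {set E}, [/\ A \subset X, clique xc K A &
    {in A &, forall x y, g (L x) + 2 <= g (R y)}].
Proof.
move=> gm gX par [cX XX].
have [x0 x0X] : exists x, x \in X by apply/set0Pn; rewrite -card_gt0 cX; lia.
have [r rX rm] := exists_min R x0X.
have meet x y : x \in X -> y \in X -> L x < R y.
  move=> xX yX; have [->|xy] := eqVneq x y; first exact: LR.
  exact/crossing_meet/XX.
pose A := [set x in X | g (L x) + 2 <= g (R r)].
have AX : A \subset X by apply/subsetP=> x; rewrite inE => /andP[].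
have BX : X :\: A \subset X by apply: subsetDl.
have cl (Y : {set E}) : Y \subset X -> clique xc #|Y| Y.
  by move=> /subsetP YX; split=> // x y /YX xX /YX yX; apply: XX.
have [le|lt] := leqP K #|A|.
  have [C CA cC] := clique_sub (cl A AX) le; exists C; split=> //.
    exact: subset_trans AX.
  move=> x y /(subsetP CA); rewrite inE => /andP[_ h] /(subsetP CA)/(subsetP AX) yX.
  by apply: leq_trans h _; apply/gm/rm.
have le : K <= #|X :\: A| by have := cardsID A X; rewrite (setIidPr AX) cX; lia.
have [C CA cC] := clique_sub (cl _ BX) le; exists C; split=> //.
  exact: subset_trans BX.
have key x : x \in C -> x \in X /\ g (R r) <= g (L x) + 1 <= g (R r) + 1.
  move=> /(subsetP CA)/setDP[xX xA]; split=> //; move: xA; rewrite inE xX /=.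
  have := gm _ _ (ltnW (meet x r xX rX)); lia.
move=> x y /key[xX kx] /key[yX ky]; have := par x y xX yX; have := gX y yX; lia.
Qed.

(** The summands pay for edges ending at the last point of their segment, edges between consecutive
    segments, and longer edges. The factors 2 come from the parity of the left segment. *)
Definition step_stacks := 1 + 2 * sep_stacks K + 2 * circle_stacks.
Definition step_queues := 2 * sep_queues K.

Lemma layout_thick j S : j <= K -> ~ thick xn xc K K S -> ~ thick xc xn K j S ->
  layout xc xn S (j * step_stacks) (j * step_queues).
Proof.
elim: j S => [|j IH] S jK nT nR.
  (* The empty family is a thick 0-rainbow. *)
  by case: nR; exists (fun _ => set0); split.
pose inner S a b := [set x in S | (a <= L x) && (R x <= b)].
pose Bad a b := thick xc xn K j (inner S a b).
pose g := seg Bad.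
have gm : {homo g : u v / u <= v} by move=> u v; apply: seg_mono.
have gLR x : g (L x) <= g (R x) by apply/gm/ltnW.
have sub_nT X : X \subset S -> ~ thick xn xc K K X.
  by move=> XS th; apply: nT; apply: thick_sub XS th.
(* Edges within one segment are split by whether they end at its last point: only the span of those
   in [S0] is sure not to be bad. *)
pose S0 := [set x in S | (g (R x) == g (L x)) && (g (R x).+1 == g (L x))].
pose Sl := [set x in S | (g (R x) == g (L x)) && (g (R x).+1 != g (L x))].
pose S1 := [set x in S | g (R x) == (g (L x)).+1].
pose S2 := [set x in S | g (L x) + 2 <= g (R x)].
have lay0 : layout xc xn S0 (j * step_stacks) (j * step_queues).
  apply: (layout_fiber (d := fun x => g (L x))) => [x y|i].
    rewrite !inE => /and3P[_ /eqP x1 _] /and3P[_ /eqP y1 _] /eqP xy.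
    have le u v : g u < g v -> u < v by rewrite !ltnNge; apply: contra => /gm.
    have lRL : R x <= L y \/ R y <= L x.
      by case: (ltngtP (g (L x)) (g (L y))) => // lt; [left|right]; apply/ltnW/le; rewrite ?x1 ?y1.
    have := LR x; have := LR y; rewrite /crossing /crossl /nesting /nestl; lia.
  set X := [set x in S0 | _].
  have XP x : x \in X -> [/\ x \in S, g (L x) = i, g (R x) = i & g (R x).+1 = i].
    by rewrite !inE => /andP[/and3P[xS /eqP a /eqP b] /eqP c]; split; rewrite // ?a ?b.
  have XS : X \subset S by apply/subsetP=> x /XP[].
  have [->|[x0 x0X]] := set_0Vmem X; first exact: layout0.
  have [a aX am] := exists_min L x0X; have [b bX bm] := exists_max R x0X.
  apply: (IH _ (ltnW jK)) => [|th]; first exact: sub_nT.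
  have B : Bad (L a) (R b).
    apply: thick_sub th; apply/subsetP=> x xX; rewrite inE (subsetP XS) //= am // bm //.
  have ab : L a <= R b by apply: leq_trans (bm a aX); apply: ltnW.
  have := seg_bad ab (ltnSn _) B; rewrite -/g.
  by have [_ -> _ _] := XP a aX; have [_ _ _ ->] := XP b bX; rewrite ltnn.
have layl : layout xc xn Sl 1 0.
  apply: layout_colorable_stack; exists (fun=> 0); split=> // x y xS yS _.
  (* If [u] crossed [v] from the left, [v] would lie in the same segment and end later, so [R u]
     would not be the last point. *)
  have cr u v : u \in Sl -> v \in Sl -> ~~ crossl L R u v.
    rewrite !inE => /and3P[uS /eqP u1 /eqP u2] /and3P[vS /eqP v1 /eqP v2].
    apply/negP=> /and3P[h1 h2 h3]; apply: u2; apply/eqP; rewrite eqn_leq.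
    have := gm _ _ h2; have := gm _ _ h3; have := gm _ _ (ltnW h1);
      have := gm _ _ (leqnSn (R u)); have := gm _ _ (ltnW h2); lia.
  by rewrite /crossing negb_or !cr.
have lay1 : layout xc xn S1 (2 * sep_stacks K) (2 * sep_queues K).
  apply: (layout_sum (d := fun x => g (L x) %% 2)) => [x _|p _]; first by rewrite ltn_mod.
  (* Left segments of equal parity that differ are at least two apart, so these edges do not
     overlap. *)
  apply: (layout_fiber (d := fun x => g (L x))) => [x y|i].
    rewrite !inE => /andP[/andP[_ /eqP x1] xp] /andP[/andP[_ /eqP y1] yp] /eqP xy.
    have le u v : g u < g v -> u < v by rewrite !ltnNge; apply: contra => /gm.
    have lRL : R x <= L y \/ R y <= L x.
      case: (ltngtP (g (L x)) (g (L y))) => // lt; [left|right]; apply/ltnW/le; rewrite ?x1 ?y1;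
        lia.
    have := LR x; have := LR y; rewrite /crossing /crossl /nesting /nestl; lia.
  set X := [set x in _ | _].
  have XP x : x \in X -> [/\ x \in S, g (L x) = i & g (R x) = i.+1].
    by rewrite !inE => /andP[/andP[/andP[xS /eqP a] _] /eqP c]; split; rewrite // a c.
  have XS : X \subset S by apply/subsetP=> x /XP[].
  apply: layout_separated => //; last 2 first.
  - exact: sub_nT.
  - by move=> th; apply: nR; apply: thick_sub XS (thick_leq jK th).
  move=> x y /XP[_ xi _] /XP[_ _ yi]; rewrite ltnNge; apply/negP=> /gm; rewrite xi yi ltnn.
  by [].
have lay2 : layout xc xn S2 (2 * circle_stacks) 0.
  apply: layout_colorable_stack.
  apply: (colorable_sum (d := fun x => g (L x) %% 2)) => [x _|p _]; first by rewrite ltn_mod.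
  apply: colorable_no_twist => A /subsetP AP cA.
  have {}AP x : x \in A -> [/\ x \in S, g (L x) + 2 <= g (R x) & g (L x) %% 2 = p].
    by move=> /AP; rewrite !inE => /andP[/andP[xS h] /eqP].
  have [||C [CA cC Cg]] := clique_window gm _ _ cA.
  - by move=> x /AP[].
  - by move=> x y /AP[_ _ ->] /AP[_ _ ->].
  have [x0 x0C] : exists x, x \in C by apply/set0Pn; rewrite -card_gt0 cC.1.
  have [l lC lm] := exists_max L x0C; have [r rC rm] := exists_min R x0C.
  have [a [b [la ab br [T [T1 T2]]]]] := seg_gap (Cg l r lC rC).
  have nst x y k : x \in C -> k < j -> y \in T k -> nestl L R x y.
    move=> xC kj yT; have [/subsetP/(_ y yT)] := T1 k kj; rewrite inE => /and3P[_ ay yb] _.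
    have := lm x xC; have := rm x xC; rewrite /nestl; lia.
  (* The [K]-twist [C] encloses the thick [j]-rainbow in the window and becomes its part number
     [j]. *)
  apply: nR; exists (fun k => if k == j then C else T k); split.
    move=> k kj; case: eqP => [_|kj'].
      by split=> //; apply/subsetP=> x /(subsetP CA)/AP[].
    have [|Ti ct] := T1 k; first by lia.
    by split=> //; apply: subset_trans Ti _; apply/subsetP=> x; rewrite inE => /andP[].
  move=> k k' kj kj'; case: (k =P j) => [->|kn]; case: (k' =P j) => [->|kn'] kk x y xT yT.
  - by rewrite eqxx in kk.
  - by rewrite /nesting (nst x y k') //; lia.
  - by rewrite nesting_sym /nesting (nst y x k) //; lia.
  - by apply: (T2 k k') => //; lia.
have := layoutU (layoutU lay0 layl) (layoutU lay1 lay2).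
rewrite !mulSn; apply: layout_sub; rewrite /step_stacks /step_queues; try lia.
apply/subsetP=> x xS; rewrite !inE xS /=; have := gLR x.
case: (g (R x).+1 == g (L x)); lia.
Qed.

End Induction.

(** * Ordered graphs *)

Section Rank.
Variable G : ordered_graph.
Implicit Types (a b : edge G).

(** Ranks turn the vertex order into natural numbers, so that edges become intervals. *)
Definition vrank (v : G) : nat := #|[set u : G | (u < v)%O]|.

Lemma vrank_lt (u v : G) : (vrank u < vrank v) = (u < v)%O.
Proof.
have lt (x y : G) : (x < y)%O -> vrank x < vrank y.
  move=> xy; apply: proper_card; apply/properP; split.
    by apply/subsetP=> z; rewrite !inE => /lt_trans; apply.
  by exists x; rewrite !inE ?xy ?ltxx.
case: (ltgtP u v) => [/lt->//|/lt|->]; last by rewrite ltnn.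
by move/ltnW; rewrite leqNgt => /negbTE.
Qed.

Lemma vrank_inj : injective vrank.
Proof. by move=> u v e; apply/eqP; rewrite eq_le !leNgt -!vrank_lt e ltnn. Qed.

Definition lrank a := vrank (lend a).
Definition rrank a := vrank (rend a).

Lemma lend_lt_rend a : (lend a < rend a)%O.
Proof. by case/andP: (valP a). Qed.

Lemma lrank_lt_rrank a : lrank a < rrank a.
Proof. by rewrite vrank_lt lend_lt_rend. Qed.

Lemma edge_eq a b : lend a = lend b -> rend a = rend b -> a = b.
Proof.
move=> e1 e2; apply/val_inj; move: e1 e2; rewrite /lend /rend.
by case: (val a) (val b) => [? ?] [? ?] /= -> ->.
Qed.

Lemma rank_inj a b : lrank a = lrank b -> rrank a = rrank b -> a = b.
Proof. by move=> /vrank_inj e1 /vrank_inj e2; apply: edge_eq. Qed.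

Lemma crossingE a b : crossing lrank rrank a b = cross a b.
Proof. by rewrite /crossing /crossl !vrank_lt. Qed.

Lemma nestingE a b : nesting lrank rrank a b = nest a b.
Proof. by rewrite /nesting /nestl !vrank_lt /nest !lend_lt_rend. Qed.

Lemma layout_mn s q :
  layout (crossing lrank rrank) (nesting lrank rrank) [set: edge G] s q -> mn G <= s + q.
Proof.
case=> h [h1 h2]; rewrite /mn; case: ex_minnP => m _; apply.
have sq : s < (s + q).+1 by rewrite ltnS leq_addr.
apply/existsP; exists (Ordinal sq) => /=; rewrite addKn.
have /choice[c cP] : forall a : edge G, exists p : 'I_s + 'I_q,
    match p with inl i => inl (i : nat) | inr j => inr (j : nat) end = h a.
  move=> a; have := h1 a (in_setT a); case: (h a) => i /= hi.
    by exists (inl (Ordinal hi)).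
  by exists (inr (Ordinal hi)).
apply/existsP; exists [ffun a => c a]; apply/andP; split; apply/forallP => i;
  apply/forall_inP => a; rewrite inE ffunE => /eqP ai;
  apply/forall_inP => b; rewrite inE ffunE => /eqP bi;
  have := h2 a b (in_setT a) (in_setT b); rewrite -!cP ai bi => /(_ erefl) /=.
  by rewrite crossingE.
by rewrite nestingE.
Qed.

End Rank.

(** * The ordered subgraph spanned by a family of edge sets *)

Section Support.
Variables (d : Order.disp_t) (T : finOrderType d) (V : {set T}).
Definition support_vertex := {v : T | v \in V}.
HB.instance Definition _ := Finite.on support_vertex.
HB.instance Definition _ := SubChoice.on support_vertex.
HB.instance Definition _ := [SubChoice_isSubOrder of support_vertex by <: with d].
End Support.

Section SpannedPattern.
Variables (G : ordered_graph) (k : nat) (T : 'I_k -> {set edge G}).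

Definition support : {set G} := \bigcup_i endpoints (T i).

(** Only the listed edges are kept, rather than the induced subgraph, so that the parts cover all
    edges of the pattern. *)
Definition span_adj : rel (support_vertex support) := fun u v =>
  [exists i, exists a in T i, ((lend a == val u) && (rend a == val v)) ||
                              ((lend a == val v) && (rend a == val u))].

Lemma span_adj_sym : symmetric span_adj.
Proof.
by move=> u v; apply/existsP/existsP => -[i /exists_inP[a aT h]]; exists i;
  apply/exists_inP; exists a; rewrite // orbC.
Qed.

Lemma span_adj_irr : irreflexive span_adj.
Proof.
move=> u; apply/negbTE/negP=> /existsP[i /exists_inP[a aT]].
by rewrite orbb => /andP[/eqP l /eqP r]; have := lend_lt_rend a; rewrite l r ltxx.
Qed.

Definition span := OrderedGraph span_adj_sym span_adj_irr.

Lemma span_adjP (u v : span) : (u < v)%O -> adj u v ->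
  exists i, exists2 a, a \in T i & lend a = val u /\ rend a = val v.
Proof.
move=> uv /existsP[i /exists_inP[a aT /orP[]/andP[/eqP l /eqP r]]]; exists i, a => //.
have := lend_lt_rend a; rewrite l r => vu.
by have := lt_trans (uv : (val u < val v)%O) vu; rewrite ltxx.
Qed.

Lemma span_edge_proof (a : edge span) :
  exists b : edge G, [/\ exists i, b \in T i, lend b = val (lend a) & rend b = val (rend a)].
Proof.
have /andP[lt ad] := valP a; have [i [b bT [l r]]] := span_adjP lt ad.
by exists b; split=> //; exists i.
Qed.

Definition span_edge (a : edge span) : edge G := sval (cid (span_edge_proof a)).

Lemma lend_span_edge a : lend (span_edge a) = val (lend a).
Proof. by rewrite /span_edge; case: cid => b /= []. Qed.

Lemma rend_span_edge a : rend (span_edge a) = val (rend a).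
Proof. by rewrite /span_edge; case: cid => b /= []. Qed.

Lemma span_edge_inj : injective span_edge.
Proof.
move=> a b e; apply: edge_eq; apply/val_inj.
  by rewrite -!lend_span_edge e.
by rewrite -!rend_span_edge e.
Qed.

Lemma cross_span_edge a b : cross (span_edge a) (span_edge b) = cross a b.
Proof. by rewrite /cross !lend_span_edge !rend_span_edge. Qed.

Lemma nest_span_edge a b : nest (span_edge a) (span_edge b) = nest a b.
Proof. by rewrite /nest !lend_span_edge !rend_span_edge. Qed.

Lemma span_edge_onto i b : b \in T i -> exists a, span_edge a = b.
Proof.
move=> bT; have lV : lend b \in support.
  by apply/bigcupP; exists i => //; rewrite inE imset_f.
have rV : rend b \in support.
  by apply/bigcupP; exists i => //; rewrite inE imset_f ?orbT.
pose u : span := Sub (lend b) lV; pose v : span := Sub (rend b) rV.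
have uv : ((u, v).1 < (u, v).2)%O && adj (u, v).1 (u, v).2.
  apply/andP; split; first exact: (lend_lt_rend b : (val u < val v)%O).
  by apply/existsP; exists i; apply/exists_inP; exists b; rewrite //= !eqxx.
exists (Sub (u, v) uv); apply: edge_eq.
  by rewrite lend_span_edge.
by rewrite rend_span_edge.
Qed.

Definition span_part i : {set edge span} := span_edge @^-1: T i.

Lemma card_span_part i : #|span_part i| = #|T i|.
Proof.
rewrite -(card_imset _ span_edge_inj); apply: eq_card => b; apply/imsetP/idP.
  by case=> a; rewrite inE => aT ->.
by move=> bT; have [a e] := span_edge_onto bT; exists a; rewrite ?inE ?e.
Qed.

Lemma span_part_cover (a : edge span) : exists i, a \in span_part i.
Proof.
by have [[i ai] _ _] := svalP (cid (span_edge_proof a)); exists i; rewrite inE.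
Qed.

Lemma span_endpoints (v : span) : exists i, v \in endpoints (span_part i).
Proof.
have /bigcupP[i _] := valP v; rewrite inE => /orP[]/imsetP[b bT e]; exists i; rewrite inE;
  have [a ab] := span_edge_onto bT; apply/orP; [left|right]; apply/imsetP; exists a;
  rewrite ?inE ?ab //; apply/val_inj; rewrite e -ab.
  by rewrite lend_span_edge.
by rewrite rend_span_edge.
Qed.

Lemma contains_span : contains G span.
Proof.
exists val; split=> [u v //|u v /existsP[i /exists_inP[a _]]].
have /andP[_ adj_a] := valP a; rewrite -/(lend a) -/(rend a) in adj_a.
by move=> /orP[]/andP[/eqP <- /eqP <-] //; rewrite adj_sym.
Qed.

End SpannedPattern.

(** Crossing or nesting edges have four distinct endpoints. *)
Lemma disjoint_endpoints (G : ordered_graph) (A B : {set edge G}) :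
  {in A & B, forall a b, cross a b || nest a b} -> [disjoint endpoints A & endpoints B].
Proof.
move=> AB; apply/pred0Pn => -[v /= /andP[]]; rewrite !inE.
move=> /orP[]/imsetP[a aA ->] /orP[]/imsetP[b bB e]; have := AB a b aA bB;
  rewrite -crossingE -nestingE /crossing /nesting /crossl /nestl /lrank /rrank e;
  have := lrank_lt_rrank a; have := lrank_lt_rrank b; rewrite /lrank /rrank ?e; lia.
Qed.

Lemma contains_thick (G : ordered_graph) k :
  thick (nesting (@lrank G) (@rrank G)) (crossing (@lrank G) (@rrank G)) k k [set: edge G] \/
  thick (crossing (@lrank G) (@rrank G)) (nesting (@lrank G) (@rrank G)) k k [set: edge G] ->
  contains_thick_pattern G k.
Proof.
move=> [] [T [T1 T2]]; pose T' (i : 'I_k) := T i; exists (span T'); split;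
  try exact: contains_span; [left|right]; exists (span_part T');
  have TT (i j : 'I_k) : i != j -> forall x y, x \in T' i -> y \in T' j -> _ := T2 i j (ltn_ord i) (ltn_ord j).
- split; [move=> i; split | | | exact: span_part_cover | exact: span_endpoints].
  + by rewrite card_span_part; have [_ []] := T1 i (ltn_ord i).
  + move=> a b; rewrite !inE => aT bT ab; rewrite -nest_span_edge -nestingE.
    by have [_ [_ ->]] := T1 i (ltn_ord i); rewrite ?(inj_eq (@span_edge_inj _ _ _)).
  + move=> i j ij; apply: disjoint_endpoints => a b; rewrite !inE => aT bT.
    by rewrite -cross_span_edge -crossingE (TT i j).
  + move=> i j ij a b; rewrite !inE => aT bT.
    by rewrite -cross_span_edge -crossingE (TT i j).
- split; [move=> i; split | | | exact: span_part_cover | exact: span_endpoints].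
  + by rewrite card_span_part; have [_ []] := T1 i (ltn_ord i).
  + move=> a b; rewrite !inE => aT bT ab; rewrite -cross_span_edge -crossingE.
    by have [_ [_ ->]] := T1 i (ltn_ord i); rewrite ?(inj_eq (@span_edge_inj _ _ _)).
  + move=> i j ij; apply: disjoint_endpoints => a b; rewrite !inE => aT bT.
    by rewrite -nest_span_edge -nestingE (TT i j) ?orbT.
  + move=> i j ij a b; rewrite !inE => aT bT.
    by rewrite -nest_span_edge -nestingE (TT i j).
Qed.

(** * The lower bound *)

Lemma pages_ge (A : finType) k (T : 'I_k -> {set A}) s q (c : A -> 'I_s + 'I_q) :
  (forall i, #|T i| = k) ->
  (forall i j u a b, i != j -> a \in T i -> b \in T j -> c a = inl u -> c b <> inl u) ->
  (forall i u a b, a \in T i -> b \in T i -> a != b -> c a = inr u -> c b <> inr u) ->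
  k <= s + q.
Proof.
move=> cT sep inj.
(* If some [T i] uses only [inr] pages, its [k] elements occupy distinct ones. Otherwise every [T i]
   uses an [inl] page, and these are distinct for different [i]. *)
have [[i iP]|/forallNP nex] := pselect (exists i, forall a, a \in T i -> exists u, c a = inr u).
  apply: (@leq_trans q); last exact: leq_addl.
  have ci : {in T i &, injective c}.
    move=> a b aT bT e; apply/eqP/negPn/negP => ab.
    by have [u cu] := iP a aT; apply: (inj i u a b aT bT ab cu); rewrite -e.
  rewrite -(cT i) -(card_in_imset ci) -[leqRHS]card_ord -(card_imset _ (@inr_inj 'I_s 'I_q)).
  apply: subset_leq_card; apply/subsetP=> _ /imsetP[a /iP[v cv] ->].
  by rewrite cv imset_f.
apply: (@leq_trans s); last exact: leq_addr.
have /choice[g gP] : forall i, exists u : 'I_s, exists2 a, a \in T i & c a = inl u.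
  move=> i; apply: contrapT => /forallNP nu; apply: (nex i) => a aT.
  by case e : (c a) => [u|u]; [case: (nu u); exists a | exists u].
rewrite -[k]card_ord -[s]card_ord; apply: (leq_card g) => i j e; apply/eqP/negPn/negP => ij.
have [a aT ca] := gP i; have [b bT cb] := gP j.
by apply: (sep i j _ a b ij aT bT ca); rewrite cb e.
Qed.

Lemma thick_pattern_le_mn (G : ordered_graph) k : contains_thick_pattern G k -> k <= mn G.
Proof.
move=> [H [pat [phi [phi_lt phi_adj]]]].
have /choice[e eP] : forall a : edge H, exists b : edge G,
    lend b = phi (lend a) /\ rend b = phi (rend a).
  move=> a; have ab : ((phi (lend a), phi (rend a)).1 < (phi (lend a), phi (rend a)).2)%O &&
      adj (phi (lend a), phi (rend a)).1 (phi (lend a), phi (rend a)).2.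
    by case/andP: (valP a) => lt ad; rewrite /= phi_lt ?phi_adj.
  by exists (Sub (phi (lend a), phi (rend a)) ab).
have crossP a b : cross a b -> cross (e a) (e b).
  rewrite /cross (eP a).1 (eP a).2 (eP b).1 (eP b).2.
  by move=> /orP[]/and3P[/phi_lt-> /phi_lt-> /phi_lt->]; rewrite ?orbT.
have nestP a b : nest a b -> nest (e a) (e b).
  rewrite /nest (eP a).1 (eP a).2 (eP b).1 (eP b).2.
  by move=> /orP[]/and3P[/phi_lt-> /phi_lt-> /phi_lt->]; rewrite ?orbT.
rewrite /mn; case: ex_minnP => m /existsP[s /existsP[c /andP[/forallP st /forallP qu]]] _.
have stP u a b : c (e a) = inl u -> c (e b) = inl u -> ~~ cross a b.
  move=> ca cb; apply: contraT; rewrite negbK => /crossP.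
  have /forall_inP/(_ (e a)) := st u; rewrite inE ca eqxx => /(_ isT)/forall_inP/(_ (e b)).
  by rewrite inE cb eqxx => /(_ isT)/negbTE->.
have quP u a b : c (e a) = inr u -> c (e b) = inr u -> ~~ nest a b.
  move=> ca cb; apply: contraT; rewrite negbK => /nestP.
  have /forall_inP/(_ (e a)) := qu u; rewrite inE ca eqxx => /(_ isT)/forall_inP/(_ (e b)).
  by rewrite inE cb eqxx => /(_ isT)/negbTE->.
have sm : s <= m by rewrite -ltnS.
case: pat => -[T [T1 _ T2 _ _]].
  rewrite -(subnKC sm);
    apply: (@pages_ge _ _ T _ _ (c \o e)) => /= [i|i j u a b ij aT bT ca cb|i u a b aT bT ab ca cb].
  - by have [] := T1 i.
  - by have := stP u a b ca cb; rewrite (T2 i j).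
  - by have := quP u a b ca cb; rewrite (T1 i).2.
(* In a thick rainbow, stacks and queues exchange their roles. *)
pose c' a := match c (e a) with inl u => inr u | inr u => inl u end.
rewrite -(subnK sm); apply: (@pages_ge _ _ T _ _ c') => [i|i j u a b ij aT bT|i u a b aT bT ab];
  rewrite /c'.
- by have [] := T1 i.
- case ca : (c (e a)) => // -[ea]; case cb : (c (e b)) => // -[eb]; subst.
  by have := quP _ a b ca cb; rewrite (T2 i j).
- case ca : (c (e a)) => // -[ea]; case cb : (c (e b)) => // -[eb]; subst.
  by have := stP _ a b ca cb; rewrite (T1 i).2.
Qed.

(** * The bound *)

(** Stacks plus queues from [layout_thick] with both [K] and [j] equal to [k.+1]. *)
Definition mn_bound k := k.+1 * step_stacks k.+1 + k.+1 * step_queues k.+1.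

Lemma mn_le_bound (G : ordered_graph) k :
  ~ contains_thick_pattern G k.+1 -> mn G <= mn_bound k.
Proof.
move=> nG; apply: layout_mn; apply: layout_thick => //.
- exact: lrank_lt_rrank.
- exact: rank_inj.
- by move=> th; apply: nG; apply: contains_thick; left.
- by move=> th; apply: nG; apply: contains_thick; right.
Qed.

(** This form is closed under sums and products, so the growth of [mn_bound] follows from its
    factors. *)
Definition exp_bounded (f : nat -> nat) := exists A D, forall k, f k <= A * D ^ k.

Lemma exp_boundedM f g : exp_bounded f -> exp_bounded g -> exp_bounded (fun k => f k * g k).
Proof.
move=> [A [D fP]] [B [F gP]]; exists (A * B), (D * F) => k.
by rewrite expnMn mulnACA leq_mul.
Qed.

Lemma exp_bounded_cst c : exp_bounded (fun _ => c).
Proof. by exists c, 1 => k; rewrite exp1n muln1. Qed.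

Lemma exp_boundedD f g : exp_bounded f -> exp_bounded g -> exp_bounded (fun k => f k + g k).
Proof.
move=> [A [D fP]] [B [F gP]]; exists (A + B), (D + F) => k.
have h a b : a ^ k <= (a + b) ^ k.
  by have [->|k0] := posnP k; [rewrite !expn0 | rewrite leq_exp2r // leq_addr].
by rewrite mulnDl leq_add // ?(leq_trans (fP k)) ?(leq_trans (gP k)) // leq_mul //
  ?[D + F]addnC h.
Qed.

Lemma exp_bounded_exp c : exp_bounded (fun k => c ^ k).
Proof. by exists 1, c => k; rewrite mul1n. Qed.

Lemma exp_bounded_id : exp_bounded id.
Proof. by exists 1, 2 => k; rewrite mul1n ltnW // ltn_expl. Qed.

Lemma exp_bounded_le f g : (forall k, f k <= g k) -> exp_bounded g -> exp_bounded f.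
Proof. by move=> fg [A [D gP]]; exists A, D => k; apply: leq_trans (gP k). Qed.

Lemma exp_bounded_mn_bound : exp_bounded mn_bound.
Proof.
have sP : exp_bounded (fun k => k.+1).
  apply: (@exp_bounded_le _ (fun k => k + 1)) => [k|]; first by rewrite addn1.
  exact: exp_boundedD exp_bounded_id (exp_bounded_cst 1).
have cP : exp_bounded (fun k => circle_stacks k.+1).
  (* The exponent [2 * (2 * k.+1)] equals [4 + 4 * k]. *)
  apply: (@exp_bounded_le _ (fun k => 4 ^ 4 * (4 ^ 4) ^ k *
      (2 * (2 * k.+1 * (2 * k.+1))))) => [k|].
    apply: leq_trans (circle_bound_le _ _) _; rewrite leq_mul // -expnS -expnM.
    by rewrite leq_exp2l //; lia.
  by do ?[apply: exp_boundedM | exact: sP | exact: exp_bounded_exp | exact: exp_bounded_cst].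
have ssP : exp_bounded (fun k => sep_stacks k.+1).
  by do ?[apply: exp_boundedM | apply: exp_boundedD | exact: sP | exact: exp_bounded_cst].
have sqP : exp_bounded (fun k => sep_queues k.+1).
  by do ?[apply: exp_boundedM | exact: sP | exact: exp_bounded_cst].
by do ?[exact: sP | exact: cP | exact: ssP | exact: sqP | exact: exp_bounded_cst |
  apply: exp_boundedM | apply: exp_boundedD].
Qed.

(** The factor [k ^ k] suffices when [W <= k], and [W ^ W] otherwise. *)
Lemma exp_le_selfexp W k : 0 < k -> W ^ k <= W ^ W * k ^ k.
Proof.
move=> k0; have [Wk|kW] := leqP W k.
  have [->|W0] := posnP W; first by rewrite exp0n.
  by rewrite -[leqLHS]mul1n leq_mul ?expn_gt0 ?W0 // leq_exp2r.
by rewrite -[leqLHS]muln1 leq_mul ?expn_gt0 ?k0 // leq_exp2l ?(ltnW kW) // (leq_ltn_trans k0).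
Qed.

Local Open Scope ring_scope.
(** From [ln (1 + x) <= x] at [x = - 1/2], and monotonicity beyond 2. *)
Lemma half_le_ln (R : realType) k : (2 <= k)%N -> 2^-1 <= ln (k%:R : R).
Proof.
move=> k2; have : ln (1 + (- 2^-1) : R) <= - 2^-1 by apply: le_ln1Dx;
  rewrite ltrN2 invf_lt1 // ltr1n.
have -> : 1 + (- 2^-1) = 2^-1 :> R by lra.
rewrite lnV ?posrE // lerN2 => /le_trans; apply.
by rewrite ler_ln ?posrE ?ltr0n ?ler_nat //; apply: leq_trans k2.
Qed.

Theorem theorem8 (R : realType) :
  exists f : nat -> nat -> nat,
    (exists C : R, forall Delta k : nat, (1 <= Delta)%N -> (2 <= k)%N ->
       (f Delta k)%:R <=
         C * (Delta%:R * k%:R ^+ (8 * k - 7)%N * (ln (k%:R : R)) ^+ k)) /\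
    (forall (G : ordered_graph) (Delta k : nat),
       max_degree G = Delta ->
       contains_thick_pattern G k ->
       (forall m : nat, contains_thick_pattern G m -> (m <= k)%N) ->
       (k <= mn G)%N /\ (mn G <= f Delta k)%N).
Proof.
exists (fun _ k => mn_bound k); split; last first.
  move=> G _ k _ Gk kmax; split; first exact: thick_pattern_le_mn.
  by apply: mn_le_bound => /kmax; rewrite ltnn.
have [A [D fP]] := exp_bounded_mn_bound.
(* As [2 * ln k] is at least 1, its [k]-th power can be multiplied in; the factor 2 in [W] absorbs
   the resulting [2 ^ k]. *)
pose W := (2 * D)%N; exists (A * W ^ W)%N%:R => Delta k D1 k2.
have k0 : (0 < k)%N by apply: leq_trans k2.
have nat_le : (mn_bound k * 2 ^ k <= A * W ^ W * (Delta * k ^ (8 * k - 7)))%N.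
  apply: (@leq_trans (A * W ^ k)).
    by rewrite /W expnMn mulnCA mulnC leq_mul2l fP orbT.
  rewrite -mulnA leq_mul2l; apply/orP; right.
  apply: leq_trans (exp_le_selfexp W k0) _; rewrite leq_mul2l; apply/orP; right.
  (* For positive [k], the exponent [k] is at most [8 * k - 7]. *)
  rewrite -[leqLHS]mul1n leq_mul // leq_exp2l //; lia.
have ln1 : 1 <= (2 * ln (k%:R : R)) ^+ k.
  by apply: exprn_ege1; have := half_le_ln R k2; lra.
apply: (@le_trans _ _ ((mn_bound k)%:R * (2 * ln (k%:R : R)) ^+ k)).
  by rewrite ler_peMr.
rewrite exprMn !mulrA ler_wpM2r //.
  by rewrite exprn_ge0 // ln_ge0 // ler1n.
by rewrite -!natrX -!natrM ler_nat -!mulnA; rewrite -mulnA in nat_le.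
Qed.
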